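(* Let $E:\mathbb{R}^d\to GL(\mathbb{R}^d)$ be an admissible exponent, $\sigma$ a finite symmetric measure on $\mathbb{S}^{d-1}$, and let $q(x,\xi)=\int_{\mathbb{R}^d\setminus\{0\}}(1-\cos(\langle y,\xi\rangle))\,\phi_x(dy)$ be the symbol of the corresponding operator-stable-like (OSL) process. Let $K\subset\mathbb{R}^d$ be compact. Then there exist constants $C_1,C_2,C_3,C_4>0$ such that (i) for all $x,\xi\in\mathbb{R}^d$: $|q(x,\xi)|\le C_1\|\xi\|^{1/\Lambda(x)}$ if $\|\xi\|\le1$, and $|q(x,\xi)|\le C_2\|\xi\|^{1/\lambda(x)}$ if $\|\xi\|\ge1$; (ii) for all $x\in K$ and every $\xi\in\mathbb{R}^d$: $|q(x,\xi)|\ge C_3\|\xi\|^{1/\lambda(x)}$ if $\|\xi\|\le1$, and $|q(x,\xi)|\ge C_4\|\xi\|^{1/\Lambda(x)}$ if $\|\xi\|\ge1$.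
   Context: $\|\cdot\|$ is the Euclidean norm on $\mathbb{R}^d$ and also the induced operator norm on $d\times d$ matrices; $\langle\cdot,\cdot\rangle$ is the Euclidean scalar product; $\mathbb{S}^{d-1}$ is the Euclidean unit sphere. For $r>0$ and a matrix $A$, $r^A:=\exp(A\ln r)$. $\lambda(x)$ and $\Lambda(x)$ denote the minimum and the maximum of the real parts of the eigenvalues of $E(x)$. Admissible exponent: a map $E:\mathbb{R}^d\to GL(\mathbb{R}^d)$ such that (E1) $E(x)$ is symmetric for every $x$; (E2) there is a constant $C>0$ with $\|E(y)-E(x)\|\le C\|y-x\|$ for all $x,y\in\mathbb{R}^d$; (E3) there is a constant $a>1/2$ with $a\le\lambda(x)$ for all $x\in\mathbb{R}^d$. The operator-stable-like Lévy measure with exponent $E(x)$ and spherical measure $\sigma$ is $$\phi_x(A)=\int_{\mathbb{S}^{d-1}}\int_0^\infty1_A(r^{E(x)}\theta)\,\frac{dr}{r^2}\,\sigma(d\theta),\qquad A\subset\mathbb{R}^d\setminus\{0\}\text{ Borel};$$ symmetric means $\sigma(A)=\sigma(-A)$ for all Borel $A\subset\mathbb{S}^{d-1}$. An operator-stable-like (OSL) process is a Markov semimartingale whose symbol is $q(x,\xi)=\int_{\mathbb{R}^d\setminus\{0\}}(1-\cos(\langle y,\xi\rangle))\,\phi_x(dy)$, where $\phi_x$ is the operator-stable-like Lévy measure with exponent $E(x)$ and symmetric spherical measure $\sigma$. Here the symbol of a process $X$ is $-\lim_{t\downarrow0}\frac1t\,\mathbb{E}^x\big(e^{i\langle X^\tau_t-x,\xi\rangle}-1\big)$,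 where $\tau$ is the first exit time of $X$ from a compact neighborhood of the starting point $x$ and $X^\tau$ is the process stopped at $\tau$, provided the limit exists and is the same for every choice of the neighborhood.
   Formalization: Part (ii) is proved under the added assumption that for every x in K the Lévy measure φ_x is full (not concentrated on a hyperplane ξ^⊥); without it (ii) is false, e.g. for σ = 0, and the assumption is necessary for (ii). Part (i) is unchanged. *)

(* Defs.v *)
From mathcomp Require Import all_boot all_order all_algebra.
From mathcomp Require Import complex.
From mathcomp Require Import all_classical all_reals all_analysis.

Set Implicit Arguments.
Unset Strict Implicit.
Unset Printing Implicit Defensive.

Import Order.TTheory GRing.Theory Num.Theory.
Import numFieldNormedType.Exports.

Local Open Scope classical_set_scope.
Local Open Scope ring_scope.

(* The library norm `|v| on matrices is the sup norm, so the Euclidean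
   structure is introduced here. Both norms define the same topology. *)
Definition dotp (R : realType) (d : nat) (u v : 'cV[R]_d) : R :=
  \sum_i u i 0 * v i 0.

Definition enorm (R : realType) (d : nat) (v : 'cV[R]_d) : R :=
  Num.sqrt (dotp v v).

Definition opnorm (R : realType) (d : nat) (A : 'M[R]_d) : R :=
  sup [set enorm (A *m v) | v in [set v : 'cV[R]_d | enorm v <= 1]].

Definition esphere (R : realType) (d : nat) : set 'cV[R]_d :=
  [set v | enorm v = 1].
Arguments esphere : clear implicits.

Definition borelV (R : realType) (d : nat) :=
  g_sigma_algebraType (@open 'cV[R]_d).

Definition mexp (R : realType) (d : nat) (A : 'M[R]_d) : 'M[R]_d :=
  lim ((fun n : nat => \sum_(0 <= k < n) (k`!%:R)^-1 *: A ^+ k) @ \oo).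

Definition rpow (R : realType) (d : nat) (r : R) (A : 'M[R]_d) : 'M[R]_d :=
  mexp (ln r *: A).

Definition re_spectrum (R : realType) (d : nat) (A : 'M[R]_d) : set R :=
  [set complex.Re z | z in
    [set z : R[i] | eigenvalue (map_mx (real_complex R) A) z]].

(* For d > 0 the set re_spectrum A is finite and nonempty, so that these
   are a minimum and a maximum. *)
Definition lambda_min (R : realType) (d : nat) (A : 'M[R]_d) : R :=
  inf (re_spectrum A).

Definition lambda_max (R : realType) (d : nat) (A : 'M[R]_d) : R :=
  sup (re_spectrum A).

Record admissible_exponent (R : realType) (d : nat)
    (E : 'cV[R]_d -> 'M[R]_d) : Prop := AdmissibleExponent {
  exponent_unit : forall x, E x \in unitmx;
  exponent_sym : forall x, (E x)^T = E x;
  exponent_lipschitz : exists2 C : R, 0 < C &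
    forall x y, opnorm (E y - E x) <= C * enorm (y - x);
  exponent_spectrum : exists2 a : R, 1 / 2 < a &
    forall x, a <= lambda_min (E x)
}.

(* A measure on the unit sphere is encoded as a Borel measure on R^d for which
   the complement of the sphere is a null set. *)
Definition spherical (R : realType) (d : nat)
    (sigma : set (borelV R d) -> \bar R) : Prop :=
  sigma (~` esphere R d) = 0%E.

Definition symmetric_measure (R : realType) (d : nat)
    (sigma : set (borelV R d) -> \bar R) : Prop :=
  forall A : set (borelV R d), measurable A -> A `<=` esphere R d ->
    sigma A = sigma [set - v | v in (A : set 'cV[R]_d)].

Definition osl_levy (R : realType) (d : nat) (E : 'cV[R]_d -> 'M[R]_d)
    (sigma : set (borelV R d) -> \bar R) (x : 'cV[R]_d)
    (A : set (borelV R d)) : \bar R :=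
  (\int[sigma]_(theta in esphere R d)
    \int[lebesgue_measure]_(r in `]0%R, +oo[)
      (\1_A (rpow r (E x) *m (theta : 'cV[R]_d)) / r ^+ 2)%:E)%E.

(* Kept in \bar R so that finiteness of the integral is not presupposed. *)
Definition osl_symbol (R : realType) (d : nat) (E : 'cV[R]_d -> 'M[R]_d)
    (sigma : set (borelV R d) -> \bar R) (x xi : 'cV[R]_d) : \bar R :=
  (\int[osl_levy E sigma x]_(y in ~` [set 0%R : 'cV[R]_d])
    (1 - cos (dotp (y : 'cV[R]_d) xi))%:E)%E.

(* The usual fullness of operator-stable laws: the measure is not concentrated
   on a proper linear subspace, equivalently on no hyperplane xi^\perp. If it
   is concentrated on xi^\perp then its symbol vanishes at every multiple
   of xi, so no lower bound by a power of the norm can hold. *)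
Definition full_measure (R : realType) (d : nat)
    (phi : set (borelV R d) -> \bar R) : Prop :=
  forall xi : 'cV[R]_d, xi != 0 ->
    phi [set y | dotp (y : 'cV[R]_d) xi != 0] != 0%E.

(* Main.v *)
Require Import Defs.
From mathcomp Require Import all_boot all_order all_algebra.
From mathcomp Require Import complex spectral.
From mathcomp Require Import all_classical all_reals all_analysis.
From mathcomp Require Import measurable_realfun measurable_fun_approximation.
From mathcomp Require Import ring lra.

Import Order.TTheory GRing.Theory Num.Theory.
Import numFieldNormedType.Exports.

Set Implicit Arguments.
Unset Strict Implicit.
Unset Printing Implicit Defensive.

Local Open Scope classical_set_scope.
Local Open Scope ring_scope.

(** The symbol is homogeneous along the flow r |-> r^E(x), and this reduces
    all four estimates to a two-sided bound on the unit sphere.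

    Integrating against the image of a weighted product measure
    ([integral_density_pushforward]) and moving the symmetric matrix r^E(x)
    to the other side of the scalar product gives ([osl_symbolE])

      q(x, xi) = int_S int_0^oo (1 - cos <theta, r^E(x) xi>) r^-2 dr sigma(dtheta),

    and the substitution r -> c r in this formula yields
    q(x, c^E(x) eta) = c q(x, eta) ([polar_symbol_scale]). By the intermediate
    value theorem every xi <> 0 is c^E(x) eta with c > 0 and |eta| = 1
    ([rpow_sphere]). As E(x) is symmetric, |xi| lies between c^Lambda(x) and
    c^lambda(x), so c <= 1 exactly when |xi| <= 1, and c is bounded above and
    below by |xi|^(1/Lambda(x)) and |xi|^(1/lambda(x)), in the order depending
    on that case ([symbol_rescaling]). It remains to find 0 < c0 <= C with
    c0 <= q(x, eta) <= C for |eta| = 1.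

    Upper bound ([polar_symbol_upper]): 1 - cos t <= min (2, t^2), and
    |<theta, r^E(x) eta>| <= r^a for r <= 1, where a > 1/2 bounds the spectra
    from below. The integrals of r^(2a-2) on ]0, 1] and of r^-2 on [1, oo[ are
    finite and do not depend on x.

    Lower bound ([polar_symbol_lower]): with r restricted to [1/n, n] the
    integrand is Lipschitz in (E(x), eta) uniformly in theta and r
    ([rpow_near]), so a truncated symbol that is positive at a point stays
    bounded below in a neighbourhood, and K times the sphere is compact. Some
    truncation is positive ([shell_symbol_neq0]): otherwise, for almost all
    theta, cos <theta, r^E(x) eta> = 1 for every r > 0; the continuous function
    r |-> <theta, r^E(x) eta> tends to 0 with r, hence vanishes identically,
    and the Levy measure is carried by the hyperplane orthogonal to eta,
    against its fullness. *)

(** * Spectral decomposition of a real symmetric matrix *)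

Lemma complex_ReD (R : realType) (x y : R[i]) :
  complex.Re (x + y) = complex.Re x + complex.Re y.
Proof. by case: x y => [a b] [c e]. Qed.

Lemma complex_Re_sum (R : realType) (I : Type) (s : seq I) (P : pred I)
    (F : I -> R[i]) :
  complex.Re (\sum_(i <- s | P i) F i) = \sum_(i <- s | P i) complex.Re (F i).
Proof. by apply: big_morph => // x y; exact: complex_ReD. Qed.

Lemma re_spectrumP (R : realType) (d : nat) (A : 'M[R]_d) (r : R) :
  re_spectrum A r <-> exists2 z : R[i],
     eigenvalue (map_mx (real_complex R) A) z & complex.Re z = r.
Proof. by split => [[z /= ? ?]|[z ? ?]]; exists z. Qed.

(** If U is a complex unitary matrix diagonalizing A, then stacking its real
    and imaginary parts gives a real matrix V, of twice the height, which is an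
    isometric embedding intertwining A with a real diagonal matrix. Taking the
    real part of a relation that is linear in U keeps it valid for both blocks;
    in exchange for the doubled dimension no real orthonormal eigenbasis has to
    be built. *)
Lemma symmetric_isometry (R : realType) (d : nat) (A : 'M[R]_d) :
  A^T = A ->
  exists (V : 'M[R]_(d + d, d)) (e : 'rV[R]_(d + d)),
    [/\ V^T *m V = 1%:M, V *m A = diag_mx e *m V &
        re_spectrum A = [set e 0 l | l in [set: 'I_(d + d)]]].
Proof.
move=> Asym.
pose C := (R[i] : numClosedFieldType).
pose B : 'M[C]_d := map_mx (real_complex R) A.
have Bherm : B \is hermsymmx.
  apply: realsym_hermsym.
    apply/is_hermitianmxP; rewrite expr0 scale1r.
    by apply/matrixP => i j; rewrite !mxE -{1}Asym mxE.
  apply/mxOverP => i j; rewrite mxE; apply/complex_realP; by exists (A i j).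
have Dreal := hermitian_spectral_diag_real Bherm.
have /hermitian_normalmx/orthomx_spectralP := Bherm.
set U := spectralmx B; set D := spectral_diag B => BE.
have Uu : U \is unitarymx by exact: spectral_unitarymx.
have UB : U *m B = diag_mx D *m U.
  by rewrite {1}BE !mulmxA mulmxV ?mul1mx // unitarymx_unit.
have UU : (map_mx Num.conj U)^T *m U = 1%:M.
  by rewrite map_trmx -invmx_unitary // mulVmx // unitarymx_unit.
pose f l := complex.Re (D 0 l).
have Df l : D 0 l = (f l)%:C%C.
  by rewrite RRe_real //; move/mxOverP : Dreal; exact.
pose V1 := map_mx (@complex.Re R) U; pose V2 := map_mx (@complex.Im R) U.
exists (col_mx V1 V2), (row_mx (\row_l f l) (\row_l f l)); split.
- rewrite tr_col_mx mul_row_col; apply/matrixP => i j.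
  have /matrixP/(_ i j)/(congr1 (@complex.Re R)) := UU.
  rewrite !mxE complex_Re_sum -big_split /=.
  rewrite (_ : complex.Re (i == j)%:R = (i == j)%:R); last by case: (i == j).
  move=> <-; apply: eq_bigr => l _; rewrite !mxE.
  by case: (U l i) (U l j) => [a b] [a' b'] /=; rewrite mulNr opprK.
- rewrite diag_mx_row mul_block_col !mul0mx addr0 add0r mul_col_mx.
  have key : forall l j, \sum_k U l k * (A k j)%:C%C = (f l)%:C%C * U l j.
    move=> l j; have /matrixP/(_ l j) := UB; rewrite mul_diag_mx !mxE Df => <-.
    by apply: eq_bigr => k _; rewrite mxE.
  congr (col_mx _ _); apply/matrixP => l j; rewrite mul_diag_mx !mxE.
    have /(congr1 (@complex.Re R)) := key l j.
    rewrite complex_Re_sum /=; case: (U l j) => a b /=.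
    rewrite mul0r subr0 => <-; apply: eq_bigr => k _; rewrite !mxE.
    by case: (U l k) => a' b' /=; rewrite mulr0 subr0.
  have /(congr1 (fun z => complex.Re (z * (- 'i%C)))) := key l j.
  rewrite mulr_suml complex_Re_sum /=; case: (U l j) => a b /=.
  rewrite !(mul0r, mulr0, subr0, add0r, addr0, oppr0, mulrN1, mulr1, mulrN, opprK).
  move=> <-; apply: eq_bigr => k _; rewrite !mxE.
  case: (U l k) => a' b' /=.
  by rewrite !(mul0r, mulr0, subr0, add0r, addr0, oppr0, mulrN1, mulr1, mulrN,
    opprK).
- apply/seteqP; split => r.
    move=> /re_spectrumP [z /eigenvalueP[v vB v0] <-].
    pose w := v *m invmx U.
    have w0 : w != 0.
      apply: contra v0 => /eqP w0.
      by rewrite -(mulmxKV (unitarymx_unit Uu) v) -/w w0 mul0mx.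
    have wD : w *m diag_mx D = z *: w.
      by rewrite /w scalemxAl -vB -/B [in RHS]BE !mulmxA mulmxK ?unitarymx_unit.
    have /rV0Pn[l wl] := w0.
    have /rowP/(_ l) := wD.
    rewrite mul_mx_diag [LHS]mxE [RHS]mxE mulrC => /(mulIf wl) <-.
    by exists (lshift d l) => //; rewrite row_mxEl mxE.
  case=> l _ <-; apply/re_spectrumP.
  have [k ->] : exists k : 'I_d, row_mx (\row_l f l) (\row_l f l) 0 l = f k.
    case: (split_ordP l) => k ->; exists k; by rewrite ?row_mxEl ?row_mxEr mxE.
  exists (D 0 k) => //; apply/eigenvalueP; exists (row k U).
    rewrite -row_mul -/B UB; apply/rowP => j.
    by rewrite mxE mul_diag_mx !mxE.
  apply/negP => /eqP Uk0.
  have := unitarymx_unit Uu; rewrite -row_free_unit => /row_freeP[W UW].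
  have /(congr1 (row k)) := UW; rewrite row_mul Uk0 mul0mx.
  by move/rowP/(_ k)/eqP; rewrite !mxE eqxx eq_sym oner_eq0.
Qed.

(** * Matrix exponential and matrix powers in an eigenframe *)

(** Coordinates in which A acts diagonally. V is only an isometric embedding:
    the target may be larger than the source, so V V^T need not be 1. *)
Definition eigenframe (R : realType) (d m : nat) (A : 'M[R]_d)
    (V : 'M[R]_(m, d)) (e : 'rV[R]_m) : Prop :=
  V^T *m V = 1%:M /\ V *m A = diag_mx e *m V.

Lemma cvg_mx_entry (R : realType) (T : Type) (F : set_system T) (FF : Filter F)
    (m n : nat) (f : T -> 'M[R]_(m, n)) (M : 'M[R]_(m, n)) :
  (forall i j, f x i j @[x --> F] --> M i j) -> f x @[x --> F] --> M.
Proof.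
move=> h; apply/cvg_ballP => eps eps0.
have : \forall x \near F, forall ij : 'I_m * 'I_n,
    ball (M ij.1 ij.2) eps (f x ij.1 ij.2).
  apply: filter_forall => -[i j].
  by have /cvg_ballP := h i j; exact.
by apply: filterS => x hx; split => // i j; exact: (hx (i, j)).
Qed.

Lemma cvg_series_expR (R : realType) (x : R) :
  series (exp_coeff x) n @[n --> \oo] --> expR x.
Proof. exact: is_cvg_series_exp_coeff. Qed.

Lemma cvg_sumr (R : realType) (T : Type) (F : set_system T) (FF : Filter F)
    (I : finType) (f : I -> T -> R) (l : I -> R) :
  (forall i, f i x @[x --> F] --> l i) ->
  \sum_i f i x @[x --> F] --> \sum_i l i.
Proof. by move=> h; apply: cvg_big => //; exact: add_continuous. Qed.

Definition mexp_partial (R : realType) (d : nat) (A : 'M[R]_d) (n : nat) : 'M[R]_d :=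
  \sum_(0 <= k < n) (k`!%:R)^-1 *: A ^+ k.

Section Eigenframe.
Context (R : realType) (d m : nat) (A : 'M[R]_d) (V : 'M[R]_(m, d)) (e : 'rV[R]_m).
Hypothesis hV : eigenframe A V e.

Let expe : 'rV[R]_m := \row_l expR (e 0 l).

Lemma eigenframe_partial (n : nat) :
  V *m mexp_partial A n = diag_mx (\row_l series (exp_coeff (e 0 l)) n) *m V.
Proof.
case: hV => _ VA.
have VAk k : V *m A ^+ k = diag_mx (\row_l e 0 l ^+ k) *m V.
  elim: k => [|k IH].
    rewrite expr0 mulmx1; apply/matrixP => i j.
    by rewrite mul_diag_mx !mxE expr0 mul1r.
  rewrite exprS mulmxA VA -mulmxA IH; apply/matrixP => i j.
  by rewrite !mul_diag_mx !mxE exprS mulrA.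
rewrite /mexp_partial mulmx_sumr; apply/matrixP => i j.
rewrite summxE mul_diag_mx !mxE /series /= mulr_suml.
apply: eq_bigr => k _; rewrite -scalemxAr VAk mxE mul_diag_mx !mxE /exp_coeff /=.
by rewrite mulrA; congr (_ * _); rewrite mulrC.
Qed.

Let cvg_part (i j : 'I_d) :
  mexp_partial A n i j @[n --> \oo] --> (V^T *m (diag_mx expe *m V)) i j.
Proof.
case: (hV) => VV _.
have E n : mexp_partial A n i j =
    \sum_l V^T i l * (series (exp_coeff (e 0 l)) n * V l j).
  rewrite -[mexp_partial A n]mul1mx -VV -mulmxA eigenframe_partial mxE.
  by apply: eq_bigr => l _; rewrite mul_diag_mx !mxE.
under eq_cvg do rewrite E.
rewrite mxE; apply: cvg_sumr => l; rewrite mul_diag_mx [X in _ * X]mxE.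
apply: cvgMr; rewrite mxE; apply: cvgMl; exact: cvg_series_expR.
Qed.

Lemma mexp_frame : mexp A = V^T *m (diag_mx expe *m V).
Proof.
apply: (cvg_lim (@norm_hausdorff _ _)).
by apply: cvg_mx_entry => i j; exact: cvg_part.
Qed.

Lemma cvg_mexp : mexp_partial A n @[n --> \oo] --> mexp A.
Proof. by rewrite mexp_frame; apply: cvg_mx_entry => i j; exact: cvg_part. Qed.

(** Limit of the intertwining relation for the partial sums. Unlike
    [mexp_frame], which loses the part orthogonal to the range of V, it lets
    exponentials be composed. *)
Lemma eigenframe_mexp : V *m mexp A = diag_mx expe *m V.
Proof.
apply/matrixP => l j.
have H1 : (V *m mexp_partial A n) l j @[n --> \oo] --> (V *m mexp A) l j.
  rewrite mxE; under eq_cvg do rewrite mxE.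
  apply: cvg_sumr => i; apply: cvgMr; rewrite mexp_frame; exact: cvg_part.
have H2 : (V *m mexp_partial A n) l j @[n --> \oo] --> (diag_mx expe *m V) l j.
  under eq_cvg do rewrite eigenframe_partial mul_diag_mx !mxE.
  rewrite mul_diag_mx !mxE; apply: cvgMl; exact: cvg_series_expR.
exact: (cvg_unique (@norm_hausdorff _ _) H1 H2).
Qed.

End Eigenframe.

Lemma eigenframeZ (R : realType) (d m : nat) (A : 'M[R]_d)
    (V : 'M[R]_(m, d)) (e : 'rV[R]_m) (s : R) :
  eigenframe A V e -> eigenframe (s *: A) V (s *: e).
Proof.
case=> VV VA; split => //.
rewrite -scalemxAr VA; apply/matrixP => i j.
by rewrite mxE !mul_diag_mx !mxE mulrA.
Qed.

Lemma dotpE (R : realType) (d : nat) (u v : 'cV[R]_d) :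
  dotp u v = (u^T *m v) 0 0.
Proof. by rewrite mxE; apply: eq_bigr => i _; rewrite mxE. Qed.

Lemma dotp_ge0 (R : realType) (d : nat) (u : 'cV[R]_d) : 0 <= dotp u u.
Proof. by apply: sumr_ge0 => i _; rewrite -expr2 sqr_ge0. Qed.

Lemma enorm_ge0 (R : realType) (d : nat) (u : 'cV[R]_d) : 0 <= enorm u.
Proof. exact: sqrtr_ge0. Qed.

Lemma enorm_sqr (R : realType) (d : nat) (u : 'cV[R]_d) :
  enorm u ^+ 2 = dotp u u.
Proof. by rewrite sqr_sqrtr // dotp_ge0. Qed.

Lemma frame_enorm_sqr (R : realType) (d m : nat) (A : 'M[R]_d)
    (V : 'M[R]_(m, d)) (e : 'rV[R]_m) (u : 'cV[R]_d) :
  eigenframe A V e -> enorm u ^+ 2 = \sum_l (V *m u) l 0 ^+ 2.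
Proof.
case=> VV _; rewrite enorm_sqr.
have -> : dotp u u = dotp (V *m u) (V *m u).
  by rewrite !dotpE trmx_mul -mulmxA [V^T *m _]mulmxA VV mul1mx.
by apply: eq_bigr => l _; rewrite expr2.
Qed.

Section Rpow.
Context (R : realType) (d m : nat) (A : 'M[R]_d) (V : 'M[R]_(m, d)) (e : 'rV[R]_m).
Hypothesis hV : eigenframe A V e.

(** In the coordinates given by V the flow r |-> r^A multiplies the l-th
    coordinate by r^(e_l); the remaining facts on r^A are read off from this. *)
Lemma rpow_frame (r : R) (l : 'I_m) (u : 'cV[R]_d) : 0 < r ->
  (V *m (rpow r A *m u)) l 0 = r `^ e 0 l * (V *m u) l 0.
Proof.
move=> r0; rewrite mulmxA /rpow (eigenframe_mexp (eigenframeZ (ln r) hV)).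
rewrite -mulmxA mul_diag_mx !mxE /powR gt_eqF //.
by rewrite [ln r * _]mulrC.
Qed.

Lemma rpow_entry (r : R) (i : 'I_d) (u : 'cV[R]_d) :
  (rpow r A *m u) i 0 =
  \sum_l V l i * (expR (ln r * e 0 l) * (V *m u) l 0).
Proof.
rewrite /rpow (mexp_frame (eigenframeZ (ln r) hV)) -2!mulmxA mxE.
by apply: eq_bigr => l _; rewrite mul_diag_mx !mxE.
Qed.

Lemma frame_inj (u v : 'cV[R]_d) :
  (forall l, (V *m u) l 0 = (V *m v) l 0) -> u = v.
Proof.
case: hV => VV _ uv; rewrite -[u]mul1mx -[v]mul1mx -VV -2!mulmxA.
by congr (_ *m _); apply/colP.
Qed.

Lemma rpow_mulV (r s : R) (u : 'cV[R]_d) : 0 < r -> 0 < s ->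
  rpow (r * s) A *m u = rpow r A *m (rpow s A *m u).
Proof.
move=> r0 s0; apply: frame_inj => l.
by rewrite !rpow_frame // ?mulr_gt0 // powRM ?ltW // mulrA.
Qed.

Lemma rpow1V (u : 'cV[R]_d) : rpow 1 A *m u = u.
Proof. by apply: frame_inj => l; rewrite rpow_frame // powR1 mul1r. Qed.

Lemma rpow_dotp (r : R) (u v : 'cV[R]_d) :
  dotp (rpow r A *m u) v = dotp u (rpow r A *m v).
Proof.
have S : (rpow r A)^T = rpow r A.
  rewrite /rpow (mexp_frame (eigenframeZ (ln r) hV)) !trmx_mul trmxK.
  by rewrite tr_diag_mx mulmxA.
by rewrite !dotpE trmx_mul S mulmxA.
Qed.

Lemma rpow_enorm_sqr (r : R) (u : 'cV[R]_d) : 0 < r ->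
  enorm (rpow r A *m u) ^+ 2 = \sum_l (r `^ e 0 l * (V *m u) l 0) ^+ 2.
Proof.
move=> r0; rewrite (frame_enorm_sqr _ hV).
by apply: eq_bigr => l _; rewrite rpow_frame.
Qed.

Lemma rpow_enorm_le (r c : R) (u : 'cV[R]_d) : 0 < r -> 0 <= c ->
  (forall l, r `^ e 0 l <= c) -> enorm (rpow r A *m u) <= c * enorm u.
Proof.
move=> r0 c0 h.
rewrite -(@ler_sqr _ (enorm _)) ?nnegrE ?mulr_ge0 ?enorm_ge0 //.
rewrite exprMn (frame_enorm_sqr u hV) rpow_enorm_sqr // mulr_sumr.
apply: ler_sum => l _; rewrite exprMn ler_wpM2r ?sqr_ge0 //.
by rewrite ler_sqr ?nnegrE ?powR_ge0.
Qed.

Lemma rpow_enorm_ge (r c : R) (u : 'cV[R]_d) : 0 < r -> 0 <= c ->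
  (forall l, c <= r `^ e 0 l) -> c * enorm u <= enorm (rpow r A *m u).
Proof.
move=> r0 c0 h.
rewrite -(@ler_sqr _ (c * _)) ?nnegrE ?mulr_ge0 ?enorm_ge0 //.
rewrite exprMn (frame_enorm_sqr u hV) rpow_enorm_sqr // mulr_sumr.
apply: ler_sum => l _; rewrite exprMn ler_wpM2r ?sqr_ge0 //.
by rewrite ler_sqr ?nnegrE ?powR_ge0.
Qed.

End Rpow.

(** * Integration against the image of a weighted measure *)

Section DensityPushforward.
Local Open Scope ereal_scope.
Context (d1 d2 : measure_display) (X : measurableType d1) (Y : measurableType d2).
Context (R : realType) (M : {measure set X -> \bar R}).
Context (T : X -> Y) (w : X -> R) (phi : set Y -> \bar R).
Hypothesis mT : measurable_fun setT T.
Hypothesis mw : measurable_fun setT w.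
Hypothesis w0 : forall x, (0 <= w x)%R.
Hypothesis phiE : forall A, measurable A ->
  phi A = \int[M]_x (\1_A (T x) * w x)%:E.

Import HBNNSimple.

Let m_mul (g : X -> R) : measurable_fun setT g ->
  measurable_fun setT (EFin \o (fun x => g x * w x)%R).
Proof. by move=> mg; apply/measurable_EFinP; exact: measurable_funM. Qed.

(** For a simple function both sides are the same finite combination of values
    of phi. *)
Lemma sintegral_density_pushforward (h : {nnsfun Y >-> R}) :
  sintegral phi h = \int[M]_x (h (T x) * w x)%:E.
Proof.
have mh r : measurable_fun setT (fun x => (r * \1_(h @^-1` [set r]) (T x))%R).
  by apply: measurable_funM => //; exact: measurableT_comp.
transitivity (\sum_(r \in range h)
    \int[M]_x (r * \1_(h @^-1` [set r]) (T x) * w x)%:E); last first.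
  rewrite -ge0_integral_fsum //; last 2 first.
  - by move=> r; exact: m_mul.
  - move=> r x _; rewrite lee_fin mulr_ge0 //.
    by have := nnfun_muleindic_ge0 h r (T x); rewrite -EFinM lee_fin.
  apply: eq_integral => x _.
  under eq_fsbigr do rewrite EFinM muleC.
  rewrite -ge0_mule_fsumr; last first.
    by move=> r; rewrite nnfun_muleindic_ge0.
  by rewrite fsumEFin // -fimfunE -EFinM mulrC.
transitivity (\sum_(r \in range h) r%:E * phi (h @^-1` [set r])).
  symmetry; apply: fsbig_widen => // r [_ rh] /=.
  rewrite (preimage10 rh) phiE // integral0_eq ?mule0 // => x _.
  by rewrite indic0 mul0r.
apply: eq_fsbigr => r /[!inE] -[y _ hy].
have r0 : (0 <= r)%R by rewrite -hy.
rewrite phiE // -ge0_integralZl_EFin //.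
- by apply: eq_integral => x _; rewrite -EFinM mulrA.
- by move=> x _; rewrite lee_fin mulr_ge0.
- by apply: m_mul; exact: measurableT_comp.
Qed.

(** The integral with respect to a set function is defined as a supremum over
    simple functions, so phi itself need not be known to be a measure: the
    inequality from below is monotone convergence for M along simple
    approximations of f. *)
Lemma integral_density_pushforward (f : Y -> \bar R) :
  measurable_fun setT f -> (forall y, 0 <= f y) ->
  \int[phi]_y f y = \int[M]_x (f (T x) * (w x)%:E).
Proof.
move=> mf f0.
have mfT : measurable_fun setT ((f \o T) \* (EFin \o w)).
  apply: emeasurable_funM; first exact: measurableT_comp.
  exact/measurable_EFinP.
have intE : \int[phi]_y f y = ereal_sup [set sintegral phi h |
    h in [set h : {nnsfun Y >-> R} | forall y, (h y)%:E <= f y]].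
  rewrite /integral patch_setT.
  have -> : f ^\- = cst 0.
    by apply/funext => y; rewrite funenegE; apply/max_idPr; rewrite leeNl oppe0.
  have -> : f ^\+ = f by apply/funext => y; rewrite funeposE; apply/max_idPl.
  set A := ereal_sup _; suff -> : ereal_sup [set sintegral phi h |
    h in [set h : {nnsfun Y >-> R} | forall y, (h y)%:E <= cst 0 y]] = 0.
    by rewrite sube0.
  have z (h : {nnsfun Y >-> R}) : (forall y, (h y)%:E <= cst 0 y) ->
      sintegral phi h = 0.
    move=> h0; rewrite sintegral_density_pushforward integral0_eq // => x _.
    have -> : h (T x) = 0%R by apply/eqP; rewrite eq_le fun_ge0 -lee_fin h0.
    by rewrite mul0r.
  apply/eqP; rewrite eq_le; apply/andP; split.
    by apply: ge_ereal_sup => _ [h /= h0 <-]; rewrite z.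
  by apply: ereal_sup_ubound; exists (@nnsfun0 _ Y R);
    [move=> y|apply: z => y]; rewrite lee_fin.
rewrite intE; apply/eqP; rewrite eq_le; apply/andP; split.
  apply: ge_ereal_sup => _ [h /= hf <-].
  rewrite sintegral_density_pushforward; apply: ge0_le_integral => //.
  - by move=> x _; rewrite lee_fin mulr_ge0.
  - by apply: m_mul; exact: measurableT_comp.
  - by move=> x _; rewrite EFinM lee_wpmul2r ?lee_fin.
pose g := nnsfun_approx measurableT mf.
have gf y : EFin \o g ^~ y @ \oo --> f y by exact: cvg_nnsfun_approx.
have g_le n y : (g n y)%:E <= f y.
  by rewrite nnsfun_approxE; apply: le_approx.
have mg n : measurable_fun setT (EFin \o (fun x => g n (T x) * w x)%R).
  by apply: m_mul; exact: measurableT_comp.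
have g0 n x : 0 <= (g n (T x) * w x)%:E by rewrite lee_fin mulr_ge0.
have nd_g x : {homo (fun n => (g n (T x) * w x)%:E) : m n / (m <= n)%N >-> m <= n}.
  move=> m n mn; rewrite lee_fin ler_wpM2r //.
  exact/lefP/nd_nnsfun_approx.
have -> : \int[M]_x (f (T x) * (w x)%:E) =
    limn (fun n => \int[M]_x (g n (T x) * w x)%:E).
  rewrite -monotone_convergence //.
  apply: eq_integral => x _; apply/esym/cvg_lim => //.
  rewrite (_ : (fun n => _) = (fun n => (w x)%:E * (g n (T x))%:E)); last first.
    by apply/funext => n; rewrite EFinM muleC.
  by rewrite muleC; apply: cvgeZl => //; exact: gf.
apply: lime_le.
  apply: ereal_nondecreasing_is_cvgn => m n mn; apply: ge0_le_integral => //.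
  - exact: mg.
  - exact: mg.
  - by move=> x _; exact: nd_g.
apply: nearW => n; rewrite -sintegral_density_pushforward.
by apply: ereal_sup_ubound; exists (g n).
Qed.
End DensityPushforward.

(** * The symbol in polar coordinates *)

Lemma measurable_coord (R : realType) (d : nat) (i : 'I_d) :
  measurable_fun [set: borelV R d] (fun v : borelV R d => (v : 'cV[R]_d) i 0).
Proof.
apply: (measurability _ (RGenOInfty.measurableE R)) => _ [_ [x ->] <-].
rewrite setTI; apply: sub_sigma_algebra.
apply: (@open_comp 'cV[R]_d R) => // v _; exact: coord_continuous.
Qed.

Definition rat_box (R : realType) (d : nat) (q : 'cV[rat]_d * nat) :
    set 'cV[R]_d :=
  [set v | forall i, `|v i 0 - ratr (q.1 i 0)| < q.2.+1%:R^-1].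

(** Second countability, in the form used to test Borel measurability
    coordinatewise. *)
Lemma open_bigcup_boxes (R : realType) (d : nat) (U : set 'cV[R]_d) :
  open U ->
  U = \bigcup_(q in [set q : 'cV[rat]_d * nat |
          rat_box q `<=` U]) rat_box q.
Proof.
move=> oU; apply/seteqP; split; last by move=> v [q /= qU vq]; exact: qU.
move=> v Uv.
have : nbhs v U by apply: open_nbhs_nbhs.
move/nbhs_ballP => [eps /= eps0 vU].
have [n neps] : exists n, 2 * n.+1%:R^-1 < eps :> R.
  have [n] := @ltr_add_invr R 0 (eps / 2) (divr_gt0 eps0 (ltr0n _ 2)).
  rewrite add0r => nE; exists n.
  by rewrite mulrC -ltr_pdivlMr.
have [q qP] : exists q : 'cV[rat]_d,
    forall i, `|v i 0 - ratr (q i 0)| < n.+1%:R^-1.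
  have H i : exists p : rat, `|v i 0 - ratr p| < n.+1%:R^-1 :> R.
    have n0 : 0 < n.+1%:R^-1 :> R by rewrite invr_gt0.
    have /rat_in_itvoo[p /itvP pP] : v i 0 - n.+1%:R^-1 < v i 0 + n.+1%:R^-1.
      by rewrite ltrD2l (lt_trans _ n0) // oppr_lt0.
    by exists p; rewrite distrC ltr_distl !pP.
  have [p pP] := choice H.
  by exists (\col_i p i) => i; rewrite mxE.
exists (q, n) => //= u uq; apply: vU; split => // i j.
rewrite (ord1 j) /ball /=.
apply: lt_trans neps; rewrite mulr2n mulrDl mul1r.
apply: le_lt_trans (ltrD (qP i) (uq i)).
rewrite [X in _ <= _ + X]distrC.
have -> : v i 0 - u i 0 = (v i 0 - ratr (q i 0)) + (ratr (q i 0) - u i 0) by ring.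
exact: ler_normD.
Qed.

Lemma measurable_fun_borelV (R : realType) (d : nat) (disp : measure_display)
    (X : measurableType disp) (f : X -> borelV R d) :
  (forall i : 'I_d, measurable_fun setT (fun x => (f x : 'cV[R]_d) i 0)) ->
  measurable_fun setT f.
Proof.
move=> mf.
apply: (@measurability _ _ X (borelV R d) setT f (@open 'cV[R]_d) erefl).
move=> _ [U oU <-].
rewrite setTI (open_bigcup_boxes oU) preimage_bigcup bigcup_mkcond.
apply: countable_bigcupT_measurable; first exact: countableP.
move=> q; case: ifPn => // _.
rewrite (_ : _ @^-1` _ = \bigcap_(i in [set: 'I_d])
   ((fun x => (f x : 'cV[R]_d) i 0) @^-1`
     [set r | `|r - ratr (q.1 i 0)| < q.2.+1%:R^-1])).
  apply: fin_bigcap_measurable => // i _.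
  rewrite -[X in measurable X]setTI; apply: mf => //.
  rewrite (_ : [set r | _] = ball (ratr (q.1 i 0) : R) q.2.+1%:R^-1); last first.
    by apply/seteqP; split => r /=; rewrite /ball /= distrC.
  exact: measurable_ball.
by apply/seteqP; split => x /= h i; [move=> _; exact: h|exact: (h i I)].
Qed.

Section Symbol.
Context (R : realType) (d : nat) (A : 'M[R]_d).
Context (sigma : {finite_measure set (borelV R d) -> \bar R}).
Context (m : nat) (V : 'M[R]_(m, d)) (e : 'rV[R]_m).
Hypothesis hV : eigenframe A V e.

(* The Levy measure is the image under T of the measure with density w with
   respect to the product of sigma and Lebesgue measure. *)
Let T (p : borelV R d * R) : borelV R d := rpow p.2 A *m (p.1 : 'cV[R]_d).

Let w (p : borelV R d * R) : R :=
  \1_(esphere R d) p.1 * (\1_(`]0, +oo[) p.2 * p.2 `^ (- 2%:R)).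

Lemma measurable_polar : measurable_fun setT T.
Proof.
apply: measurable_fun_borelV => i; rewrite /T.
under eq_fun do rewrite (rpow_entry hV).
apply: measurable_sum => l; apply: measurable_funM => //.
apply: measurable_funM.
  apply: measurableT_comp => //; apply: measurable_funM => //.
  by apply: measurableT_comp => //; exact: measurable_snd.
under eq_fun do rewrite mxE.
apply: measurable_sum => j; apply: measurable_funM => //.
apply: (measurableT_comp (measurable_coord j)); exact: measurable_fst.
Qed.

Lemma continuous_enorm : continuous (@enorm R d).
Proof.
move=> v; apply: continuous_comp; last exact: sqrt_continuous.
apply: (@cvg_sumr _ _ (nbhs v)) => i; apply: cvgM; exact: coord_continuous.
Qed.

Lemma measurable_esphere : measurable (esphere R d : set (borelV R d)).
Proof.
rewrite -[X in measurable X]setCK; apply: measurableC; apply: sub_sigma_algebra.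
have -> : ~` esphere R d = @enorm R d @^-1` [set~ 1] by [].
apply: open_comp; first by move=> v _; exact: continuous_enorm.
exact/closed_openC/closed_eq.
Qed.

Lemma measurable_polar_density : measurable_fun setT w.
Proof.
apply: measurable_funM.
  apply: measurableT_comp => //; apply: measurable_indic.
  exact: measurable_esphere.
apply: measurable_funM.
  by apply: measurableT_comp => //; apply: measurable_indic; exact: measurable_itv.
exact: (measurableT_comp (measurable_powR _)).
Qed.

Lemma polar_density_ge0 p : 0 <= w p.
Proof. by rewrite /w !mulr_ge0 ?powR_ge0. Qed.

Lemma polar_fubini (g : borelV R d -> R) :
  measurable_fun setT g -> (forall y, 0 <= g y) ->
  (\int[sigma]_(theta in esphere R d)
    \int[lebesgue_measure]_(r in `]0%R, +oo[)
      (g (rpow r A *m (theta : 'cV[R]_d)) / r ^+ 2)%:E =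
  \int[sigma \x lebesgue_measure]_p (g (T p) * w p)%:E)%E.
Proof.
move=> mg g0.
rewrite fubini_tonelli1; last 2 first.
- apply/measurable_EFinP; apply: measurable_funM.
    apply: measurableT_comp => //; exact: measurable_polar.
  exact: measurable_polar_density.
- by move=> p; rewrite lee_fin mulr_ge0 // polar_density_ge0.
rewrite integral_mkcond; apply: eq_integral => th _.
rewrite /fubini_F patchE; case: ifPn => hth; last first.
  rewrite integral0_eq // => r _.
  by rewrite /w /= indicE (negbTE hth) mul0r mulr0.
rewrite [LHS]integral_mkcond; apply: eq_integral => r _.
rewrite patchE /w /T /= !indicE hth mul1r.
case: ifPn => hr; last by rewrite mul0r mulr0.
move: hr; rewrite inE /= in_itv /= andbT => r0.
by rewrite mul1r powR_invn // ltW.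
Qed.

Lemma osl_integral (E : 'cV[R]_d -> 'M[R]_d) (x : 'cV[R]_d) (g : borelV R d -> R) :
  E x = A -> measurable_fun setT g -> (forall y, 0 <= g y) ->
  (\int[osl_levy E sigma x]_y (g y)%:E =
  \int[sigma]_(theta in esphere R d)
    \int[lebesgue_measure]_(r in `]0%R, +oo[)
      (g (rpow r A *m (theta : 'cV[R]_d)) / r ^+ 2)%:E)%E.
Proof.
move=> Ex mg g0.
rewrite (@integral_density_pushforward _ _ _ _ R (sigma \x lebesgue_measure)%E T w).
- by rewrite polar_fubini.
- exact: measurable_polar.
- exact: measurable_polar_density.
- exact: polar_density_ge0.
- move=> B mB; by rewrite /osl_levy Ex polar_fubini //.
- exact/measurable_EFinP.
- by move=> y; rewrite lee_fin.
Qed.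

Lemma measurable_dotp (xi : 'cV[R]_d) :
  measurable_fun setT (fun y : borelV R d => dotp (y : 'cV[R]_d) xi).
Proof.
apply: measurable_sum => i; apply: measurable_funM => //; exact: measurable_coord.
Qed.

(** The symmetry of r^A is used to let it act on xi, which makes the scaling in
    xi visible. The point y = 0, excluded in the definition of the symbol,
    carries the value 1 - cos 0 = 0. *)
Lemma osl_symbolE (E : 'cV[R]_d -> 'M[R]_d) (x xi : 'cV[R]_d) : E x = A ->
  (osl_symbol E sigma x xi =
  \int[sigma]_(theta in esphere R d)
    \int[lebesgue_measure]_(r in `]0%R, +oo[)
      ((1 - cos (dotp (theta : 'cV[R]_d) (rpow r A *m xi))) / r ^+ 2)%:E)%E.
Proof.
move=> Ex; pose g (y : borelV R d) := 1 - cos (dotp (y : 'cV[R]_d) xi).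
have g0 y : 0 <= g y by rewrite subr_ge0 cos_le1.
have mg : measurable_fun setT g.
  apply: measurable_funB => //.
  apply: (measurableT_comp (f := @cos R)); last exact: measurable_dotp.
  apply: continuous_measurable_fun; exact: continuous_cos.
transitivity (\int[osl_levy E sigma x]_y (g y)%:E)%E.
  rewrite /osl_symbol /integral.
  suff -> : (fun y : borelV R d => (g y)%:E) \_ setT =
            (fun y : borelV R d => (g y)%:E) \_ (~` [set 0 : 'cV[R]_d]) by [].
  apply/funext => y; rewrite !patchE in_setT.
  case: ifPn => // /negP; rewrite inE /= => y0.
  have -> : y = (0 : 'cV[R]_d) by apply: contrapT => ?; exact: y0.
  rewrite /g (_ : dotp 0 xi = 0) ?cos0 ?subrr //.
  by rewrite /dotp big1 // => i _; rewrite mxE mul0r.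
rewrite (osl_integral Ex mg g0); apply: eq_integral => th _.
by apply: eq_integral => r _; rewrite /g (rpow_dotp hV).
Qed.

End Symbol.

(** * Dilations of the half-line *)

(** Lebesgue measure is c times its image under x |-> c x: both agree on
    intervals. *)
Lemma ge0_integral_dilation (R : realType) (c : R) (f : R -> \bar R) : 0 < c ->
  measurable_fun setT f -> (forall r, 0 <= f r)%E ->
  (\int[lebesgue_measure]_r f r =
   c%:E * \int[lebesgue_measure]_r f (c * r)%R)%E.
Proof.
move=> c0 mf f0.
have mc : measurable_fun [set: measurableTypeR R]
    ( *%R c : measurableTypeR R -> measurableTypeR R).
  by apply: measurable_funM.
pose push : {measure set (measurableTypeR R) -> \bar R} :=
  measure_function_pushforward__canonical__measure_function_Measure
    lebesgue_measure mc.
pose nu := mscale (NngNum (ltW c0)) push.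
have nuE (B : set (measurableTypeR R)) : measurable B -> lebesgue_measure B = nu B.
  move=> mB; apply: lebesgue_measure_unique => //= _ [[a b]] _ <-.
  rewrite /nu /mscale /= /pushforward /=.
  rewrite (_ : _ @^-1` _ = `](c^-1 * a), (c^-1 * b)]%classic); last first.
    apply/seteqP; split => x /=; rewrite !in_itv /= => /andP[xa xb];
      apply/andP; split.
    - by rewrite ltr_pdivrMl.
    - by rewrite ler_pdivlMl.
    - by rewrite -ltr_pdivrMl.
    - by rewrite -ler_pdivlMl.
  rewrite !lebesgue_measure_itv /= !lte_fin ltr_pM2l ?invr_gt0 //.
  case: ifPn => ab; last by rewrite mule0.
  by rewrite -!EFinD -EFinM -mulrBr mulrA mulfV ?mul1r // gt_eqF.
transitivity (\int[nu]_r f r)%E.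
  by apply: eq_measure_integral => B mB _; exact: nuE.
rewrite ge0_integral_mscale //; congr (_ * _)%E.
by rewrite (ge0_integral_pushforward mc).
Qed.

Lemma measurable_fun_cos (R : realType) : measurable_fun setT (@cos R).
Proof. by apply: continuous_measurable_fun; exact: continuous_cos. Qed.

(** The weight r^-2 contributes c^2 and the dilation c^-1. *)
Lemma ge0_integral_dilation_itv (R : realType) (c : R) (k : R -> R) : 0 < c ->
  measurable_fun setT k -> (forall r, 0 <= k r) ->
  (\int[lebesgue_measure]_(r in `]0%R, +oo[) (k (c * r) / r ^+ 2)%:E =
   c%:E * \int[lebesgue_measure]_(r in `]0%R, +oo[) (k r / r ^+ 2)%:E)%E.
Proof.
move=> c0 mk k0.
pose f r : \bar R := (\1_(`]0, +oo[) r * (k r * r `^ (- 2%:R)))%:E.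
have f0 r : (0 <= f r)%E by rewrite lee_fin !mulr_ge0 ?powR_ge0.
have mf : measurable_fun setT f.
  apply/measurable_EFinP; apply: measurable_funM.
    by apply: measurable_indic; exact: measurable_itv.
  by apply: measurable_funM => //; exact: measurable_powR.
have fE r : f r = ((fun r => (k r / r ^+ 2)%:E) \_ `]0%R, +oo[) r.
  rewrite /f patchE indicE; case: ifPn => r0; last by rewrite mul0r.
  move: r0; rewrite inE /= in_itv /= andbT => r0.
  by rewrite mul1r powR_invn // ltW.
have -> : (\int[lebesgue_measure]_(r in `]0%R, +oo[) (k r / r ^+ 2)%:E =
          \int[lebesgue_measure]_r f r)%E.
  by rewrite integral_mkcond; apply: eq_integral => r _; rewrite fE.
rewrite (ge0_integral_dilation c0 mf f0) muleA -EFinM.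
rewrite -ge0_integralZl_EFin //; last 2 first.
- by apply: measurableT_comp => //; apply: measurable_funM.
- by rewrite mulr_ge0 // ltW.
rewrite [LHS]integral_mkcond; apply: eq_integral => r _.
rewrite fE !patchE !mem_setE !in_itv /= !andbT pmulr_rgt0 //.
case: ifPn => // r0; last by rewrite mule0.
rewrite -EFinM; congr EFin.
have rn0 : r != 0 by rewrite gt_eqF.
by field; rewrite rn0 gt_eqF.
Qed.

(** * Elementary inequalities *)

Lemma le1_derive_lipschitz (R : realType) (f df : R -> R) :
  (forall x : R, is_derive x 1 f (df x)) -> (forall x, `|df x| <= 1) ->
  forall a b, `|f a - f b| <= `|a - b|.
Proof.
move=> fd df1 a b; wlog ab : a b / a <= b.
  move=> H; case/orP: (le_total a b) => ?; last rewrite distrC [leRHS]distrC.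
    exact: H.
  exact: H.
have [|c _ E] := MVT_segment ab (fun x _ => fd x).
  by apply: derivable_within_continuous => x _; apply: ex_derive.
rewrite distrC E normrM [leRHS]distrC.
by apply: ler_piMl.
Qed.

Lemma cos_lipschitz (R : realType) (a b : R) : `|cos a - cos b| <= `|a - b|.
Proof.
apply: (le1_derive_lipschitz (df := fun x => - sin x)) => x.
by rewrite normrN sin_max.
Qed.

Lemma sin_lipschitz (R : realType) (a b : R) : `|sin a - sin b| <= `|a - b|.
Proof. by apply: (le1_derive_lipschitz (df := @cos R)) => x; exact: cos_max. Qed.

(** 1 - cos t = 2 sin^2 (t / 2). *)
Lemma one_sub_cos_le (R : realType) (t : R) : 1 - cos t <= t ^+ 2.
Proof.
have -> : 1 - cos t = 2 * sin (t / 2) ^+ 2.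
  rewrite {1}(_ : t = (t / 2) *+ 2); last by rewrite -mulr_natr divfK.
  by rewrite cos_mulr2n cos2sin2 mulr2n; ring.
have : `|sin (t / 2)| <= `|t / 2|.
  by have := sin_lipschitz (t / 2) 0; rewrite sin0 !subr0.
rewrite -ler_sqr ?nnegrE // !real_normK ?num_real // => h.
have := sqr_ge0 t; rewrite exprMn in h; move: h; rewrite exprVn => h h'.
lra.
Qed.

Lemma dotpDl (R : realType) (d : nat) (u v z : 'cV[R]_d) :
  dotp (u + v) z = dotp u z + dotp v z.
Proof. by rewrite -big_split; apply: eq_bigr => i _; rewrite mxE mulrDl. Qed.

Lemma dotpZl (R : realType) (d : nat) (c : R) (u z : 'cV[R]_d) :
  dotp (c *: u) z = c * dotp u z.
Proof. by rewrite mulr_sumr; apply: eq_bigr => i _; rewrite mxE mulrA. Qed.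

Lemma dotpC (R : realType) (d : nat) (u v : 'cV[R]_d) : dotp u v = dotp v u.
Proof. by apply: eq_bigr => i _; rewrite mulrC. Qed.

Lemma enorm_eq0 (R : realType) (d : nat) (u : 'cV[R]_d) : enorm u = 0 -> u = 0.
Proof.
move=> u0; have : dotp u u = 0 by rewrite -enorm_sqr u0 expr0n.
move/eqP; rewrite psumr_eq0 => [/allP uP|i _]; last by rewrite -expr2 sqr_ge0.
apply/colP => i; rewrite mxE.
by have /eqP := uP i (mem_index_enum _); move/eqP; rewrite mulf_eq0 orbb => /eqP.
Qed.

Lemma dotp_le (R : realType) (d : nat) (u v : 'cV[R]_d) :
  dotp u v <= enorm u * enorm v.
Proof.
have [u0|u0] := eqVneq (enorm u) 0.
  by rewrite u0 (enorm_eq0 u0) mul0r /dotp big1 // => i _; rewrite mxE mul0r.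
have [v0|v0] := eqVneq (enorm v) 0.
  by rewrite v0 (enorm_eq0 v0) mulr0 /dotp big1 // => i _; rewrite mxE mulr0.
have up : 0 < enorm u by rewrite lt_neqAle eq_sym u0 enorm_ge0.
have vp : 0 < enorm v by rewrite lt_neqAle eq_sym v0 enorm_ge0.
(* The vectors |v| u and |u| v have the same norm; expand their distance. *)
have := dotp_ge0 (enorm v *: u - enorm u *: v).
rewrite -scaleNr dotpDl !dotpZl [dotp u _]dotpC [dotp v _]dotpC !dotpDl !dotpZl.
rewrite -!enorm_sqr [dotp v u]dotpC => h.
have {}h : 0 <= (enorm u * enorm v) * (enorm u * enorm v - dotp u v).
  move: h; set a := enorm u; set b := enorm v; set c := dotp u v => h.
  have -> : a * b * (a * b - c) =
      (b * (b * a ^+ 2 + - a * c) + - a * (b * c + - a * b ^+ 2)) / 2.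
    by field.
  by rewrite divr_ge0.
by move: h; rewrite pmulr_rge0 ?mulr_gt0 // subr_ge0.
Qed.

Lemma norm_dotp_le (R : realType) (d : nat) (u v : 'cV[R]_d) :
  `|dotp u v| <= enorm u * enorm v.
Proof.
rewrite ler_norml dotp_le andbT lerNl -mulN1r -dotpZl scaleN1r.
have -> : enorm u = enorm (- u).
  rewrite /enorm; congr Num.sqrt; apply: eq_bigr => i _.
  by rewrite mxE mulrNN.
exact: dotp_le.
Qed.

Lemma integral_powR_itv (R : realType) (p s t : R) : p != 0 -> 0 < s -> s < t ->
  (\int[lebesgue_measure]_(r in `[s, t]) (r `^ (p - 1))%:E =
   ((t `^ p - s `^ p) / p)%:E)%E.
Proof.
move=> p0 s0 st.
have pos x : x \in `[s, t] -> 0 < x.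
  by rewrite in_itv /= => /andP[sx _]; exact: lt_le_trans sx.
have der q x : x \in `[s, t] -> derivable (@powR R ^~ q) x 1.
  by move=> /pos x0; apply: derivable_powR; rewrite in_itv /= andbT.
have cont q x : x \in `[s, t] -> {for x, continuous (@powR R ^~ q)}.
  by move=> /der dx; apply/differentiable_continuous/derivable1_diffP; exact: dx.
rewrite (@continuous_FTC2 _ _ (fun x => p^-1 * x `^ p)) //.
- by rewrite -EFinD; congr EFin; rewrite mulrBl ![_ / p]mulrC.
- by apply: derivable_within_continuous => x; exact: der.
- split.
  + move=> x xst; apply: derivableM => //; apply: der.
    exact: subset_itv_oo_cc xst.
  + apply: cvg_at_right_filter; apply: cvgMr; apply: cont.
    by rewrite in_itv /= lexx ltW.
  + apply: cvg_at_left_filter; apply: cvgMr; apply: cont.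
    by rewrite in_itv /= lexx ltW.
- move=> x xst; have xst' := subset_itv_oo_cc xst.
  rewrite derive1E deriveM //; last exact: der.
  rewrite derive_cst scaler0 addr0 -derive1E powR_derive1; last first.
    by rewrite in_itv /= andbT; exact: pos.
  by rewrite /GRing.scale /= mulrA mulVf ?mul1r.
Qed.

(** * Scaling of the symbol *)

(** At r = 0 both r^-2 and |r|^(-2) are 0 by convention, so that the identity
    with a real power holds on the whole line. *)
Lemma measurable_invr_sqr (R : realType) :
  measurable_fun setT (fun r : R => (r ^+ 2)^-1).
Proof.
rewrite (_ : (fun r : R => _) = (fun r => `|r| `^ (- 2%:R))).
  by apply: (measurableT_comp (measurable_powR _)).
apply/funext => r; rewrite powR_invn ?real_normK ?num_real //.
Qed.

Lemma measurable_fun_inner (R : realType) (disp : measure_display)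
    (X : measurableType disp)
    (G : X * R -> R) (D : set R) : measurable D ->
  measurable_fun setT G -> (forall p, 0 <= G p) ->
  measurable_fun setT (fun x => \int[lebesgue_measure]_(r in D) (G (x, r))%:E)%E.
Proof.
move=> mD mG G0.
pose f (p : X * measurableTypeR R) : \bar R := (\1_D p.2 * G p)%:E.
have := @measurable_fun_fubini_tonelli_F _ _ X (measurableTypeR R) R
  lebesgue_measure f.
rewrite (_ : fubini_F _ f =
    (fun x => \int[lebesgue_measure]_(r in D) (G (x, r))%:E)%E); last first.
  apply/funext => x; rewrite /fubini_F [RHS]integral_mkcond.
  apply: eq_integral => r _; rewrite patchE /f /= indicE.
  by case: ifPn; rewrite ?mul1r ?mul0r.
apply.
- apply/measurable_EFinP; apply: measurable_funM => //.
  apply: measurableT_comp; last exact: measurable_snd.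
  exact: measurable_indic.
- by move=> p; rewrite lee_fin mulr_ge0.
Qed.

Definition osl_kernel (R : realType) (d : nat) (A : 'M[R]_d) (xi : 'cV[R]_d)
    (p : borelV R d * R) : R :=
  1 - cos (dotp (p.1 : 'cV[R]_d) (rpow p.2 A *m xi)).

(** The right-hand side of [osl_symbolE]. It depends on x only through the
    matrix A = E(x). *)
Definition polar_symbol (R : realType) (d : nat) (A : 'M[R]_d)
    (sigma : set (borelV R d) -> \bar R) (xi : 'cV[R]_d) : \bar R :=
  (\int[sigma]_(theta in esphere R d)
    \int[lebesgue_measure]_(r in `]0%R, +oo[)
      (osl_kernel A xi (theta, r) / r ^+ 2)%:E)%E.

Lemma osl_kernel_ge0 (R : realType) (d : nat) (A : 'M[R]_d) (xi : 'cV[R]_d) p :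
  0 <= osl_kernel A xi p.
Proof. by rewrite subr_ge0 cos_le1. Qed.

Section Kernel.
Context (R : realType) (d m : nat) (A : 'M[R]_d) (V : 'M[R]_(m, d)) (e : 'rV[R]_m).
Hypothesis hV : eigenframe A V e.
Implicit Types (xi eta : 'cV[R]_d).

Lemma measurable_osl_kernel xi : measurable_fun setT (osl_kernel A xi).
Proof.
apply: measurable_funB => //.
apply: (measurableT_comp (f := @cos R)); first exact: measurable_fun_cos.
apply: measurable_sum => i; apply: measurable_funM.
  apply: (measurableT_comp (measurable_coord i)); exact: measurable_fst.
under eq_fun do rewrite (rpow_entry hV).
apply: measurable_sum => l; apply: measurable_funM => //.
apply: measurable_funM => //.
apply: measurableT_comp => //; apply: measurable_funM => //.
by apply: measurableT_comp => //; exact: measurable_snd.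
Qed.

Lemma osl_kernel_scale xi th (r c : R) : 0 < r -> 0 < c ->
  osl_kernel A (rpow c A *m xi) (th, r) = osl_kernel A xi (th, c * r).
Proof.
move=> r0 c0.
have E : rpow (c * r) A *m xi = rpow r A *m (rpow c A *m xi).
  by rewrite [c * r]mulrC; exact: (rpow_mulV hV).
by rewrite /osl_kernel [(th, r).2]/= [(th, c * r).2]/= E.
Qed.

Lemma measurable_kernel_density xi :
  measurable_fun setT (fun p : borelV R d * R => osl_kernel A xi p / p.2 ^+ 2).
Proof.
apply: measurable_funM; first exact: measurable_osl_kernel.
by apply: (measurableT_comp (@measurable_invr_sqr R)); exact: measurable_snd.
Qed.

Lemma measurable_inner_symbol xi :
  measurable_fun setT (fun theta : borelV R d =>
    \int[lebesgue_measure]_(r in `]0%R, +oo[)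
      (osl_kernel A xi (theta, r) / r ^+ 2)%:E)%E.
Proof.
apply: (@measurable_fun_inner R _ (borelV R d)
  (fun p => osl_kernel A xi p / p.2 ^+ 2)) => //.
- exact: measurable_kernel_density.
- by move=> p; rewrite mulr_ge0 ?osl_kernel_ge0 // invr_ge0 sqr_ge0.
Qed.

Lemma inner_symbol_ge0 xi th (D : set R) :
  (0 <= \int[lebesgue_measure]_(r in D) (osl_kernel A xi (th, r) / r ^+ 2)%:E)%E.
Proof.
apply: integral_ge0 => r _.
by rewrite lee_fin mulr_ge0 ?osl_kernel_ge0 // invr_ge0 sqr_ge0.
Qed.

(** The group law r^A c^A = (r c)^A turns the action of c^A on xi into a
    dilation of the radial variable. *)
Lemma polar_symbol_scale (sigma : {finite_measure set (borelV R d) -> \bar R})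
    (c : R) xi :
  0 < c ->
  (polar_symbol A sigma (rpow c A *m xi) = c%:E * polar_symbol A sigma xi)%E.
Proof.
move=> c0; rewrite /polar_symbol -ge0_integralZl_EFin ?ltW //.
- apply: eq_integral => th _.
  rewrite -(@ge0_integral_dilation_itv _ c (fun r => osl_kernel A xi (th, r))) //.
  + apply: eq_integral => r; rewrite inE /= in_itv /= andbT => r0.
    by rewrite osl_kernel_scale.
  + apply: (measurableT_comp (measurable_osl_kernel xi)).
    exact: pair1_measurable.
  + by move=> r; exact: osl_kernel_ge0.
- exact: measurable_esphere.
- by move=> th _; exact: inner_symbol_ge0.
- apply: measurable_funTS; exact: measurable_inner_symbol.
Qed.

End Kernel.

(** * The upper bound on the unit sphere *)

Lemma integral_bigcup_le (R : realType) (F : (set R)^nat) (f : R -> R)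
    (C : \bar R) :
  nondecreasing_seq F -> (forall n, measurable (F n)) ->
  measurable_fun setT f -> (forall r, 0 <= f r) ->
  (forall n, \int[lebesgue_measure]_(r in F n) (f r)%:E <= C)%E ->
  (\int[lebesgue_measure]_(r in \bigcup_n F n) (f r)%:E <= C)%E.
Proof.
move=> ndF mF mf f0 FC.
have cv := @ge0_nondecreasing_set_cvg_integral _ (measurableTypeR R) R F
  (EFin \o f) lebesgue_measure ndF mF.
have {}cv : (\int[lebesgue_measure]_(r in F n) (f r)%:E)%E @[n --> \oo] -->
    (\int[lebesgue_measure]_(r in \bigcup_n F n) (f r)%:E)%E.
  apply: cv => [n|n r _]; last by rewrite /= lee_fin.
  by apply: measurable_funTS; exact/measurable_EFinP.
have <- := cvg_lim (@ereal_hausdorff R) cv.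
by apply: lime_le; [apply/cvg_ex; eexists; exact: cv|exact: nearW].
Qed.

Lemma integral_powR_itvoc01 (R : realType) (p : R) : 0 < p ->
  (\int[lebesgue_measure]_(r in `]0%R, 1%R]) (r `^ (p - 1))%:E <= p^-1%:E)%E.
Proof.
move=> p0.
have -> : `]0%R, 1%R]%classic = \bigcup_n `[(n.+2%:R : R)^-1, 1]%classic.
  apply/seteqP; split => r /=; rewrite in_itv /=.
    move=> /andP[r0 r1].
    have [n] := ltr_add_invr r0; rewrite add0r => nr.
    exists n => //=; rewrite in_itv /= r1 andbT.
    apply: le_trans (ltW nr); rewrite lef_pV2 ?posrE // ler_nat //.
  case=> n _ /=; rewrite in_itv /= => /andP[nr ->]; rewrite andbT.
  by apply: lt_le_trans nr; rewrite invr_gt0.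
apply: integral_bigcup_le => //.
- move=> m n mn; apply/subsetPset => r /=; rewrite !in_itv /= => /andP[mr ->].
  rewrite andbT; apply: le_trans mr.
  by rewrite lef_pV2 ?posrE // ler_nat.
- by move=> r; exact: powR_ge0.
- move=> n; rewrite integral_powR_itv ?gt_eqF ?invr_gt0 //; last first.
    by rewrite invf_lt1 // ltr1n.
  by rewrite lee_fin powR1 ler_pdivrMr // mulVf ?gt_eqF // gerBl powR_ge0.
Qed.

Lemma integral_powR_itvcy1 (R : realType) :
  (\int[lebesgue_measure]_(r in `[(1 : R)%R, +oo[) (r `^ (- 1 - 1))%:E <= 1)%E.
Proof.
have -> : `[1%R : R, +oo[%classic = \bigcup_n `[1 : R, n.+2%:R]%classic.
  apply/seteqP; split => r /=; rewrite in_itv /= ?andbT.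
    move=> r1; exists (Num.truncn r) => //=; rewrite in_itv /= r1 /=.
    have r0 : 0 <= r by lra.
    have /andP[_ /ltW h] := truncn_itv r0.
    by apply: (le_trans h); rewrite ler_nat.
  by case=> n _ /=; rewrite in_itv /= => /andP[].
apply: integral_bigcup_le => //.
- move=> m n mn; apply/subsetPset => r /=; rewrite !in_itv /= => /andP[-> mr] /=.
  by apply: (le_trans mr); rewrite ler_nat.
- by move=> r; exact: powR_ge0.
- move=> n; rewrite integral_powR_itv ?oppr_eq0 ?oner_eq0 ?ltr1n //.
  rewrite lee_fin powR1 invrN1 mulrN1 opprB.
  by rewrite gerBl powR_ge0.
Qed.

(** The singularity at 0 is integrable because k is quadratically small there
    and 2 a - 2 > -1; at infinity boundedness of k is enough. *)
Lemma integral_quadratic_bound (R : realType) (a : R) (k : R -> R) :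
  1 / 2 < a -> measurable_fun setT k -> (forall r, 0 <= k r <= 2) ->
  (forall r, 0 < r -> r <= 1 -> k r <= (r `^ a) ^+ 2) ->
  (\int[lebesgue_measure]_(r in `]0%R, +oo[) (k r / r ^+ 2)%:E <=
   ((2 * a - 1)^-1 + 2)%:E)%E.
Proof.
move=> a2 mk k02 ka.
have p0 : 0 < 2 * a - 1 by lra.
have k0 r : 0 <= k r by have /andP[] := k02 r.
have f0 r : (0 <= (k r / r ^+ 2)%:E)%E.
  by rewrite lee_fin mulr_ge0 // invr_ge0 sqr_ge0.
have mf : measurable_fun setT (fun r => k r / r ^+ 2).
  by apply: measurable_funM => //; exact: measurable_invr_sqr.
have -> : `]0%R, +oo[%classic = `]0, 1] `|` `]1%R : R, +oo[.
  by rewrite -itv_bndbnd_setU // bnd_simp.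
rewrite ge0_integral_setU //=; last 2 first.
- by apply: measurable_funTS; exact/measurable_EFinP.
- rewrite disj_set2E; apply/eqP/seteqP; split => r //= [].
  by rewrite !in_itv /= andbT => /andP[_]; rewrite leNgt => /negP.
rewrite EFinD; apply: leeD.
  apply: le_trans (integral_powR_itvoc01 p0).
  apply: ge0_le_integral => //.
  - by apply: measurable_funTS; exact/measurable_EFinP.
  - by apply: measurable_funTS; apply/measurable_EFinP; exact: measurable_powR.
  - move=> r /=; rewrite in_itv /= => /andP[r0 r1]; rewrite lee_fin.
    rewrite ler_pdivrMr ?exprn_gt0 //.
    apply: (le_trans (ka _ r0 r1)).
    rewrite -(powR_mulrn 2 (powR_ge0 r a)) -(powR_mulrn 2 (ltW r0)) -powRrM.
    rewrite -powRD ?(gt_eqF r0) ?implybT //.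
    by rewrite (_ : 2 * a - 1 - 1 + 2 = a * 2) //; ring.
apply: (@le_trans _ _ (\int[lebesgue_measure]_(r in `[(1 : R)%R, +oo[)
    (2%:E * (r `^ (- 1 - 1))%:E))%E).
  apply: (@le_trans _ _ (\int[lebesgue_measure]_(r in `[(1 : R)%R, +oo[)
      (k r / r ^+ 2)%:E)%E).
    apply: ge0_subset_integral => //.
    - by apply: measurable_funTS; exact/measurable_EFinP.
    - by apply: subset_itvr; rewrite bnd_simp.
  apply: ge0_le_integral => //.
  - by apply: measurable_funTS; exact/measurable_EFinP.
  - apply: measurable_funTS; apply: measurable_funeM.
    by apply/measurable_EFinP; exact: measurable_powR.
  - move=> r /=; rewrite in_itv /= andbT => r1.
    have r0 : 0 <= r by lra.
    rewrite -EFinM lee_fin (_ : -1 - 1 = - 2%:R); last by ring.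
    rewrite powR_invn // ler_wpM2r ?invr_ge0 ?sqr_ge0 //.
    by have /andP[] := k02 r.
rewrite ge0_integralZl_EFin //.
- by rewrite -[leRHS]mule1 lee_wpmul2l // integral_powR_itvcy1.
- by move=> r _; rewrite lee_fin powR_ge0.
- by apply: measurable_funTS; apply/measurable_EFinP; exact: measurable_powR.
Qed.

(** The bound involves the matrix only through a lower bound a of its
    eigenvalues, so it is uniform for an admissible exponent. *)
Lemma polar_symbol_upper (R : realType) (d m : nat) (A : 'M[R]_d)
    (V : 'M[R]_(m, d)) (e : 'rV[R]_m)
    (sigma : {finite_measure set (borelV R d) -> \bar R}) (a : R) (eta : 'cV[R]_d) :
  eigenframe A V e -> 1 / 2 < a -> (forall l, a <= e 0 l) -> enorm eta = 1 ->
  (polar_symbol A sigma eta <=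
   ((2 * a - 1)^-1 + 2)%:E * sigma (esphere R d))%E.
Proof.
move=> hV a2 ae eta1.
have mS := @measurable_esphere R d.
rewrite /polar_symbol -integral_cst //.
apply: ge0_le_integral => //.
- by move=> th _; exact: inner_symbol_ge0.
- apply: measurable_funTS; exact: (measurable_inner_symbol hV).
- move=> th th1; apply: integral_quadratic_bound => //.
  + apply: (measurableT_comp (measurable_osl_kernel hV eta)).
    exact: pair1_measurable.
  + move=> r; rewrite osl_kernel_ge0 /= /osl_kernel.
    have := cos_geN1 (dotp (th : 'cV[R]_d) (rpow r A *m eta)) => /=; lra.
  + move=> r r0 r1; apply: (le_trans (one_sub_cos_le _)).
    rewrite -[leLHS]real_normK ?num_real // ler_sqr ?nnegrE ?powR_ge0 //.
    apply: (le_trans (norm_dotp_le _ _)); rewrite th1 mul1r.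
    rewrite -[leRHS]mulr1 -eta1; apply: (rpow_enorm_le hV) => //.
      exact: powR_ge0.
    by move=> l; apply: ger_powR => //; rewrite r0 r1.
Qed.

(** * Lipschitz dependence of the matrix exponential *)

Lemma ler_enormD (R : realType) (d : nat) (u v : 'cV[R]_d) :
  enorm (u + v) <= enorm u + enorm v.
Proof.
rewrite -ler_sqr ?nnegrE ?addr_ge0 ?enorm_ge0 // enorm_sqr.
rewrite dotpDl [dotp u _]dotpC [dotp v _]dotpC !dotpDl -!enorm_sqr [dotp v u]dotpC.
by have := dotp_le u v; lra.
Qed.

Lemma enormZ (R : realType) (d : nat) (c : R) (u : 'cV[R]_d) :
  enorm (c *: u) = `|c| * enorm u.
Proof.
rewrite /enorm dotpZl dotpC dotpZl mulrA -expr2 sqrtrM ?sqr_ge0 //.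
by rewrite sqrtr_sqr.
Qed.

Lemma enorm0 (R : realType) (d : nat) : enorm (0 : 'cV[R]_d) = 0.
Proof. by rewrite -(scale0r 0) enormZ normr0 mul0r. Qed.

Lemma enorm_gt0 (R : realType) (d : nat) (u : 'cV[R]_d) : u != 0 -> 0 < enorm u.
Proof.
move=> u0; rewrite lt_neqAle enorm_ge0 andbT eq_sym.
by apply: contra u0 => /eqP/enorm_eq0 ->.
Qed.

Lemma ler_enorm_sum (R : realType) (d : nat) (I : Type) (s : seq I) (P : pred I)
    (F : I -> 'cV[R]_d) :
  enorm (\sum_(i <- s | P i) F i) <= \sum_(i <- s | P i) enorm (F i).
Proof.
elim/big_ind2 : _ => // [|u a v b ua vb]; first by rewrite enorm0.
exact: le_trans (ler_enormD _ _) (lerD ua vb).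
Qed.

(** Operator norm bounds are handled as a relation, which avoids computing with
    the supremum that defines [opnorm]. *)
Definition opbound (R : realType) (d : nat) (A : 'M[R]_d) (c : R) : Prop :=
  forall v, enorm (A *m v) <= c * enorm v.

Section Opbound.
Context (R : realType) (d : nat).
Implicit Types (A B : 'M[R]_d) (v : 'cV[R]_d).

Lemma opbound_symmetric A : A^T = A -> exists2 c, 0 <= c & opbound A c.
Proof.
move=> /symmetric_isometry[V [e [VV VA _]]].
have hV : eigenframe A V e by split.
exists (\sum_l `|e 0 l|); first by apply: sumr_ge0.
move=> v; rewrite -ler_sqr ?nnegrE ?mulr_ge0 ?enorm_ge0 ?sumr_ge0 //.
rewrite exprMn !(frame_enorm_sqr _ hV) mulr_sumr.
apply: ler_sum => l _; rewrite mulmxA VA -mulmxA mul_diag_mx !mxE exprMn.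
rewrite ler_wpM2r ?sqr_ge0 // -real_normK ?num_real //.
rewrite ler_sqr ?nnegrE ?sumr_ge0 // (bigD1 l) //= lerDl.
exact: sumr_ge0.
Qed.

(** The supremum defining [opnorm] is over a bounded set: an eigenframe shows
    this for a symmetric matrix. *)
Lemma opnorm_bound A : A^T = A -> opbound A (opnorm A).
Proof.
move=> Asym v; have [->|v0] := eqVneq v 0.
  by rewrite mulmx0 enorm0 mulr0.
have vp := enorm_gt0 v0.
have [c c0 Ac] := opbound_symmetric Asym.
have : enorm (A *m ((enorm v)^-1 *: v)) <= opnorm A.
  apply: ub_le_sup.
    exists c => _ [u /= u1 <-]; apply: (le_trans (Ac u)).
    by rewrite -[leRHS]mulr1 ler_wpM2l.
  exists ((enorm v)^-1 *: v) => //=.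
  by rewrite enormZ ger0_norm ?invr_ge0 ?enorm_ge0 // mulVf ?gt_eqF.
rewrite -scalemxAr enormZ ger0_norm ?invr_ge0 ?enorm_ge0 //.
by rewrite mulrC ler_pdivrMr.
Qed.

Lemma opboundD A B a b : opbound A a -> opbound B b -> opbound (A + B) (a + b).
Proof.
move=> Aa Bb v; rewrite mulmxDl mulrDl.
exact: le_trans (ler_enormD _ _) (lerD (Aa v) (Bb v)).
Qed.

Lemma opboundM A B a b : 0 <= a ->
  opbound A a -> opbound B b -> opbound (A *m B) (a * b).
Proof.
move=> a0 Aa Bb v; rewrite -mulmxA; apply: (le_trans (Aa _)).
by rewrite -mulrA ler_wpM2l.
Qed.

Lemma opboundZ A a s : opbound A a -> opbound (s *: A) (`|s| * a).
Proof. by move=> Aa v; rewrite -scalemxAl enormZ -mulrA ler_wpM2l. Qed.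

Lemma opbound_le A a b : a <= b -> opbound A a -> opbound A b.
Proof.
by move=> ab Aa v; apply: (le_trans (Aa v)); rewrite ler_wpM2r ?enorm_ge0.
Qed.

Lemma opboundX A a k : 0 <= a -> opbound A a -> opbound (A ^+ k) (a ^+ k).
Proof.
move=> a0 Aa; elim: k => [|k IH]; first by move=> v; rewrite !expr0 mul1mx mul1r.
rewrite !exprS; exact: (opboundM a0 Aa IH).
Qed.

(** From A^(k+2) - B^(k+2) = A (A^(k+1) - B^(k+1)) + (A - B) B^(k+1). *)
Lemma opboundXB A B M c k : 0 <= M -> 0 <= c -> opbound A M -> opbound B M ->
  opbound (A - B) c -> opbound (A ^+ k.+1 - B ^+ k.+1) (k.+1%:R * M ^+ k * c).
Proof.
move=> M0 c0 AM BM ABc; elim: k => [|k IH].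
  by rewrite !expr1 expr0 !mul1r.
have -> : A ^+ k.+2 - B ^+ k.+2 =
    A *m (A ^+ k.+1 - B ^+ k.+1) + (A - B) *m B ^+ k.+1.
  by rewrite mulmxBr mulmxBl [A ^+ k.+2]exprS [B ^+ k.+2]exprS addrA subrK.
have -> : k.+2%:R * M ^+ k.+1 * c = M * (k.+1%:R * M ^+ k * c) + c * M ^+ k.+1.
  by rewrite -[k.+2]add1n natrD exprS; ring.
apply: opboundD; first exact: opboundM.
apply: opboundM => //; last exact: opboundX.
Qed.

Lemma series_exp_coeff_le (M : R) n :
  0 <= M -> series (exp_coeff M) n <= expR M.
Proof.
move=> M0; rewrite -(cvg_lim (@Rhausdorff R) (@cvg_series_expR R M)).
apply: nondecreasing_cvgn_le; last exact: is_cvg_series_exp_coeff.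
apply/nondecreasing_seqP => k; rewrite /series /= big_nat_recr //= lerDl.
exact: exp_coeff_ge0.
Qed.

Lemma opbound_partial A M n :
  0 <= M -> opbound A M -> opbound (mexp_partial A n) (expR M).
Proof.
move=> M0 AM v; rewrite /mexp_partial mulmx_suml.
apply: (le_trans (ler_enorm_sum _ _ _)).
apply: (@le_trans _ _ (series (exp_coeff M) n * enorm v)); last first.
  by rewrite ler_wpM2r ?enorm_ge0 // series_exp_coeff_le.
rewrite /series /= mulr_suml; apply: ler_sum => k _.
rewrite -scalemxAl enormZ ger0_norm ?invr_ge0 // /exp_coeff /= -mulrA.
rewrite mulrCA mulrA; apply: le_trans (_ : (k`!%:R)^-1 * (M ^+ k * enorm v) <= _).
  by rewrite ler_wpM2l ?invr_ge0 //; exact: opboundX.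
by rewrite mulrA [_^-1 * _]mulrC.
Qed.

(** The k-th term contributes at most M^(k-1) / (k-1)! times c, which sums to
    at most e^M c. *)
Lemma opbound_partialB A B M c n : 0 <= M -> 0 <= c -> opbound A M -> opbound B M ->
  opbound (A - B) c -> opbound (mexp_partial A n - mexp_partial B n) (expR M * c).
Proof.
move=> M0 c0 AM BM ABc v; rewrite /mexp_partial -sumrB mulmx_suml.
apply: (le_trans (ler_enorm_sum _ _ _)).
case: n => [|n].
  by rewrite big_geq // !mulr_ge0 ?expR_ge0 ?enorm_ge0.
rewrite big_nat_recl //= !expr0 subrr mul0mx enorm0 add0r.
apply: (@le_trans _ _ (series (exp_coeff M) n * c * enorm v)); last first.
  by rewrite !ler_wpM2r ?enorm_ge0 // series_exp_coeff_le.
rewrite /series /= -mulrA mulr_suml; apply: ler_sum => k _.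
rewrite -scalerBr -scalemxAl enormZ ger0_norm ?invr_ge0 // /exp_coeff /=.
apply: le_trans (_ : (k.+1`!%:R)^-1 * (k.+1%:R * M ^+ k * c * enorm v) <= _).
  by rewrite ler_wpM2l ?invr_ge0 //; exact: opboundXB.
rewrite factS natrM invfM.
have k1 : k.+1%:R != 0 :> R by rewrite pnatr_eq0.
have k2 : k`!%:R != 0 :> R by rewrite pnatr_eq0 -lt0n fact_gt0.
rewrite le_eqVlt; apply/orP; left; apply/eqP.
move: k1 k2; move: (k.+1%:R : R) (k`!%:R : R) => p q p0 q0.
by field; rewrite ?p0 ?q0.
Qed.
End Opbound.

Lemma enorm_cvg_le (R : realType) (d : nat) (f : nat -> 'cV[R]_d)
    (l : 'cV[R]_d) (c : R) :
  f n @[n --> \oo] --> l -> (forall n, enorm (f n) <= c) -> enorm l <= c.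
Proof.
move=> fl fc.
have H : enorm (f n) @[n --> \oo] --> enorm l.
  by apply: (cvg_comp _ _ fl); exact: continuous_enorm.
rewrite -(cvg_lim (@Rhausdorff R) H).
apply: limr_le; first by apply/cvg_ex; exists (enorm l).
exact: nearW.
Qed.

Lemma cvg_mulmx_col (R : realType) (d : nat) (f : nat -> 'M[R]_d)
    (l : 'M[R]_d) (v : 'cV[R]_d) :
  f n @[n --> \oo] --> l -> (f n *m v) @[n --> \oo] --> l *m v.
Proof.
move=> fl; apply: cvg_mx_entry => i j; rewrite mxE.
under eq_cvg do rewrite mxE.
apply: cvg_sumr => k; apply: cvgMl.
exact: (cvg_comp f (fun M : 'M[R]_d => M i k) fl (@coord_continuous _ _ _ i k l)).
Qed.

Lemma cvg_mexp_symmetric (R : realType) (d : nat) (A : 'M[R]_d) :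
  A^T = A -> mexp_partial A n @[n --> \oo] --> mexp A.
Proof.
move=> /symmetric_isometry[V [e [VV VA _]]].
exact: (cvg_mexp (conj VV VA)).
Qed.

Lemma opbound_mexp (R : realType) (d : nat) (A : 'M[R]_d) M :
  A^T = A -> 0 <= M -> opbound A M -> opbound (mexp A) (expR M).
Proof.
move=> As M0 AM v.
apply: (enorm_cvg_le (cvg_mulmx_col (cvg_mexp_symmetric As))) => n.
exact: opbound_partial.
Qed.

Lemma opbound_mexpB (R : realType) (d : nat) (A B : 'M[R]_d) M c :
  A^T = A -> B^T = B -> 0 <= M -> 0 <= c -> opbound A M -> opbound B M ->
  opbound (A - B) c -> opbound (mexp A - mexp B) (expR M * c).
Proof.
move=> As Bs M0 c0 AM BM ABc v.
have H : mexp_partial A n - mexp_partial B n @[n --> \oo] --> mexp A - mexp B.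
  by apply: cvgB; exact: cvg_mexp_symmetric.
apply: (enorm_cvg_le (cvg_mulmx_col H)) => n.
exact: (opbound_partialB n M0 c0 AM BM ABc).
Qed.

(** * Continuity of matrix powers and rescaling to the unit sphere *)

(** Uniformity in r on compact subsets of ]0, oo[ is what makes the truncated
    symbol continuous. *)
Lemma rpow_near (R : realType) (d : nat) (E : 'cV[R]_d -> 'M[R]_d)
    (hE : admissible_exponent E) (x0 xi0 : 'cV[R]_d) (s eps : R) :
  0 <= s -> 0 < eps ->
  exists2 delta, 0 < delta & forall x xi,
    enorm (x - x0) <= delta -> enorm (xi - xi0) <= delta ->
    forall r, `|ln r| <= s ->
    enorm (rpow r (E x) *m xi - rpow r (E x0) *m xi0) <= eps.
Proof.
move=> s0 eps0; have [_ Esym [C C0 EC] _] := hE.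
have [L0 L00 EL0] := opbound_symmetric (Esym x0).
(* Within distance 1/C of x0 the norm of E x is at most L0 + 1, so K bounds the
   norm of r^(E x) when |ln r| <= s. *)
pose K := expR (s * (L0 + 1)).
have K0 : 0 < K by exact: expR_gt0.
have z0 := enorm_ge0 xi0.
have D0 : 0 < 1 + s * C * enorm xi0.
  by rewrite ltr_wpDr // !mulr_ge0 // ltW.
pose delta := Num.min C^-1 (eps / (K * (1 + s * C * enorm xi0))).
have delta0 : 0 < delta by rewrite lt_min invr_gt0 C0 divr_gt0 ?mulr_gt0.
exists delta => // x xi xd xid r rs.
have Cd : C * delta <= 1.
  by rewrite -[leRHS](mulfV (lt0r_neq0 C0)) ler_pM2l // ge_min lexx.
have symD : (E x - E x0)^T = E x - E x0 by rewrite linearB /= !Esym.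
have Edif : opbound (E x - E x0) (C * delta).
  apply: opbound_le (opnorm_bound symD); apply: (le_trans (EC _ _)).
  by rewrite ler_pM2l.
have EL : opbound (E x) (L0 + 1).
  have -> : E x = E x0 + (E x - E x0) by rewrite addrC subrK.
  by apply: opboundD => //; exact: opbound_le Edif.
have EL' : opbound (E x0) (L0 + 1) by apply: opbound_le EL0; rewrite lerDl.
have symZ t y : (t *: E y)^T = t *: E y by rewrite linearZ /= Esym.
have bnd y : opbound (E y) (L0 + 1) -> opbound (ln r *: E y) (s * (L0 + 1)).
  move=> /(opboundZ (ln r)); apply: opbound_le.
  by rewrite ler_wpM2r // addr_ge0.
have M0 : 0 <= s * (L0 + 1) by rewrite mulr_ge0 // addr_ge0.
have -> : rpow r (E x) *m xi - rpow r (E x0) *m xi0 =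
    rpow r (E x) *m (xi - xi0) + (rpow r (E x) - rpow r (E x0)) *m xi0.
  by rewrite mulmxBr mulmxBl addrA subrK.
apply: (le_trans (ler_enormD _ _)).
apply: (@le_trans _ _ (K * delta + K * (s * (C * delta)) * enorm xi0)).
  apply: lerD.
    apply: (le_trans (opbound_mexp (symZ _ _) M0 (bnd _ EL) _)).
    by rewrite ler_pM2l.
  apply: (opbound_mexpB (symZ _ _) (symZ _ _) M0 _ (bnd _ EL) (bnd _ EL')).
    by rewrite !mulr_ge0 // ltW.
  rewrite -scalerBr; apply: opbound_le (opboundZ (ln r) Edif).
  by rewrite ler_wpM2r // mulr_ge0 // ltW.
have -> : K * delta + K * (s * (C * delta)) * enorm xi0 =
    delta * (K * (1 + s * C * enorm xi0)) by ring.
by rewrite -ler_pdivlMr ?mulr_gt0 // ge_min lexx orbT.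
Qed.

Lemma rpow_entry_continuous (R : realType) (d m : nat) (A : 'M[R]_d)
    (V : 'M[R]_(m, d)) (e : 'rV[R]_m) (v : 'cV[R]_d) (i : 'I_d) (r : R) :
  eigenframe A V e -> 0 < r ->
  (rpow u A *m v) i 0 @[u --> r] --> (rpow r A *m v) i 0.
Proof.
move=> hV r0; rewrite (rpow_entry hV); under eq_cvg do rewrite (rpow_entry hV).
apply: (@cvg_sumr _ _ (nbhs r)) => l; apply: cvgMr; apply: cvgMl.
apply: continuous_comp; last exact: continuous_expR.
by apply: cvgMl; exact: continuous_ln.
Qed.

Lemma rpow_dotp_continuous (R : realType) (d m : nat) (A : 'M[R]_d)
    (V : 'M[R]_(m, d)) (e : 'rV[R]_m) (u v : 'cV[R]_d) (r : R) :
  eigenframe A V e -> 0 < r ->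
  {for r, continuous (fun r : R => dotp u (rpow r A *m v))}.
Proof.
move=> hV r0; apply: (@cvg_sumr _ _ (nbhs r)) => i; apply: cvgMr.
exact: rpow_entry_continuous hV r0.
Qed.

(** The sphere is the image under transposition of a closed subset of the cube
    [-1, 1]^d of row vectors. *)
Lemma compact_esphere (R : realType) (d : nat) : compact (esphere R d).
Proof.
have ct : continuous (fun w : 'rV[R]_d => w^T).
  move=> w; apply: (@cvg_mx_entry _ _ (nbhs w)) => i j.
  under eq_cvg do rewrite mxE.
  by rewrite mxE; exact: coord_continuous.
pose S : set 'rV[R]_d := [set w | esphere R d w^T].
have -> : esphere R d = [set w^T | w in S].
  apply/seteqP; split => [v v1|_ [w wS <-]//].
  by exists v^T; rewrite /S /= trmxK.
apply: continuous_compact; first exact: continuous_subspaceT.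
have cube : compact [set v : 'rV[R]_d | forall i, `[-1, 1]%classic (v ord0 i)].
  by apply: (@rV_compact R d (fun=> `[-1, 1]%classic)) => i; exact: segment_compact.
apply: subclosed_compact _ cube _.
  apply: (@closed_comp _ _ (fun w : 'rV[R]_d => enorm w^T) [set 1]).
    move=> w _; apply: continuous_comp; first exact: ct.
    exact: continuous_enorm.
  exact: closed_eq.
move=> w /= w1 i; rewrite in_itv /= -ler_norml.
have <- : dotp (\col_j (j == i)%:R) w^T = w ord0 i.
  rewrite /dotp (bigD1 i) //= big1 => [|j ji].
    by rewrite !mxE eqxx mul1r addr0.
  by rewrite !mxE (negbTE ji) mul0r.
apply: (le_trans (norm_dotp_le _ _)); rewrite w1 mulr1.
rewrite /enorm /dotp (bigD1 i) //= big1 => [|j ji].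
  by rewrite !mxE eqxx mul1r addr0 sqrtr1.
by rewrite !mxE (negbTE ji) mul0r.
Qed.

(** The norm of r^A xi is at most 1 for small r and at least 1 for large r, so
    it equals 1 somewhere. *)
Lemma rpow_sphere (R : realType) (d m : nat) (A : 'M[R]_d)
    (V : 'M[R]_(m, d)) (e : 'rV[R]_m) (a : R) (xi : 'cV[R]_d) :
  eigenframe A V e -> 0 < a -> (forall l, a <= e 0 l) -> xi != 0 ->
  exists c eta, [/\ 0 < c, enorm eta = 1 & xi = rpow c A *m eta].
Proof.
move=> hV a0 ae xi0.
have xp := enorm_gt0 xi0.
pose f r := enorm (rpow r A *m xi) ^+ 2.
have cf r : 0 < r -> {for r, continuous f}.
  move=> r0; have fE : f = fun r => \sum_i (rpow r A *m xi) i 0 ^+ 2.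
    apply/funext => u; rewrite /f enorm_sqr.
    by apply: eq_bigr => i _; rewrite expr2.
  rewrite fE; apply: (@cvg_sumr _ _ (nbhs r)) => i.
  have entry := rpow_entry_continuous (v := xi) (i := i) hV r0.
  by rewrite expr2; under eq_cvg do rewrite expr2; exact: cvgM.
(* q^a |xi| = 1, so the bounds by r^a |xi| settle the two ends of the interval
   [min (1, q), max (1, q)]. *)
pose q := (enorm xi) `^ (- a^-1).
have q0 : 0 < q by exact: powR_gt0.
have qa : q `^ a = (enorm xi)^-1.
  by rewrite /q -powRrM mulNr mulVf ?gt_eqF // powR_inv1 // ltW.
pose lo := Num.min 1 q; pose hi := Num.max 1 q.
have lo0 : 0 < lo by rewrite lt_min ltr01 q0.
have lohi : lo <= hi by rewrite le_max ge_min lexx.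
have hi0 := lt_le_trans lo0 lohi.
have flo : f lo <= 1.
  rewrite expr_le1 ?enorm_ge0 //; apply: le_trans (_ : lo `^ a * enorm xi <= _).
    apply: (rpow_enorm_le hV) => //; first exact: powR_ge0.
    by move=> l; apply: ger_powR => //; rewrite lo0 /lo ge_min lexx.
  rewrite -(mulVf (lt0r_neq0 xp)) ler_pM2r // -qa.
  apply: ge0_ler_powR; rewrite ?nnegrE ?(ltW lo0) ?(ltW q0) ?(ltW a0) //.
  by rewrite /lo ge_min lexx orbT.
have fhi : 1 <= f hi.
  rewrite expr_ge1 ?enorm_ge0 //; apply: le_trans (_ : _ <= hi `^ a * enorm xi) _.
    rewrite -(mulVf (lt0r_neq0 xp)) ler_pM2r // -qa.
    apply: ge0_ler_powR; rewrite ?nnegrE ?(ltW hi0) ?(ltW q0) ?(ltW a0) //.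
    by rewrite /hi le_max lexx orbT.
  apply: (rpow_enorm_ge hV) => //; first exact: powR_ge0.
  by move=> l; apply: ler_powR => //; rewrite /hi le_max lexx.
have [||c clohi fc] := @IVT R f lo hi 1 lohi.
- apply/continuous_in_subspaceT => r; rewrite inE /= in_itv /= => /andP[lor _].
  by apply: cf; exact: lt_le_trans lor.
- move: flo fhi; move: (f lo) (f hi) => y z y1 z1.
  by rewrite ge_min le_max y1 z1 orbT.
have c0 : 0 < c by move: clohi; rewrite in_itv /= => /andP[+ _]; exact: lt_le_trans.
exists c^-1, (rpow c A *m xi); split; first by rewrite invr_gt0.
  by apply/eqP; rewrite -(@eqrXn2 _ 2) ?enorm_ge0 // expr1n; apply/eqP.
by rewrite -(rpow_mulV hV) ?invr_gt0 // mulVf ?gt_eqF // (rpow1V hV).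
Qed.

(** * Truncation of the radial integral *)

(** The index is shifted by one so that the inverse is meaningful for n = 0. *)
Definition shell (R : realType) (n : nat) : set R :=
  `[n.+1%:R^-1, n.+1%:R]%classic.
Arguments shell : clear implicits.

Lemma measurable_shell (R : realType) n : measurable (shell R n).
Proof. exact: measurable_itv. Qed.

Lemma shell_gt0 (R : realType) n r : shell R n r -> 0 < r.
Proof.
rewrite /shell /= in_itv /= => /andP[h _].
by apply: lt_le_trans h; rewrite invr_gt0.
Qed.

Lemma lebesgue_measure_shell (R : realType) n :
  (lebesgue_measure (shell R n) <= n.+1%:R%:E)%E.
Proof.
rewrite /shell lebesgue_measure_itv /= lte_fin; case: ifPn => // _.
  by rewrite -EFinD lee_fin gerBl invr_ge0.
Qed.

(** The weight r^-2 is dropped: on a shell it is bounded below by a positive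
    constant, and only lower bounds are drawn from this quantity. *)
Definition shell_symbol (R : realType) (d : nat) (A : 'M[R]_d)
    (sigma : set (borelV R d) -> \bar R) (n : nat) (xi : 'cV[R]_d) : \bar R :=
  (\int[sigma]_(theta in esphere R d)
    \int[lebesgue_measure]_(r in shell R n) (osl_kernel A xi (theta, r))%:E)%E.

Section Shell.
Context (R : realType) (d : nat).
Context (sigma : {finite_measure set (borelV R d) -> \bar R}).
Implicit Types (xi : 'cV[R]_d) (th : borelV R d).

Let mS := @measurable_esphere R d.

Lemma measurable_kernel_slice m (A : 'M[R]_d) (V : 'M[R]_(m, d))
    (e : 'rV[R]_m) xi th :
  eigenframe A V e -> measurable_fun setT (fun r => osl_kernel A xi (th, r)).
Proof.
move=> hV; apply: (measurableT_comp (measurable_osl_kernel hV xi)).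
exact: pair1_measurable.
Qed.

Lemma measurable_inner_shell m (A : 'M[R]_d) (V : 'M[R]_(m, d))
    (e : 'rV[R]_m) n xi :
  eigenframe A V e ->
  measurable_fun setT (fun theta : borelV R d =>
    \int[lebesgue_measure]_(r in shell R n) (osl_kernel A xi (theta, r))%:E)%E.
Proof.
move=> hV; apply: (@measurable_fun_inner R _ (borelV R d) (osl_kernel A xi)).
- exact: measurable_shell.
- exact: (measurable_osl_kernel hV).
- by move=> p; exact: osl_kernel_ge0.
Qed.

Lemma inner_shell_ge0 A n xi th :
  (0 <= \int[lebesgue_measure]_(r in shell R n) (osl_kernel A xi (th, r))%:E)%E.
Proof. by apply: integral_ge0 => r _; rewrite lee_fin osl_kernel_ge0. Qed.

Lemma shell_symbol_ge0 A n xi : (0 <= shell_symbol A sigma n xi)%E.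
Proof. by apply: integral_ge0 => th _; exact: inner_shell_ge0. Qed.

Lemma shell_symbol_le m (A : 'M[R]_d) (V : 'M[R]_(m, d)) (e : 'rV[R]_m) n xi :
  eigenframe A V e ->
  (((n.+1%:R ^+ 2)^-1)%:E * shell_symbol A sigma n xi <= polar_symbol A sigma xi)%E.
Proof.
move=> hV; set c := (n.+1%:R ^+ 2)^-1 : R.
have c0 : 0 <= c by rewrite invr_ge0 sqr_ge0.
rewrite /shell_symbol -ge0_integralZl_EFin //; last 2 first.
- by move=> th _; exact: inner_shell_ge0.
- by apply: measurable_funTS; exact: (measurable_inner_shell _ _ hV).
apply: ge0_le_integral => //.
- by move=> th _; rewrite mule_ge0 // inner_shell_ge0.
- apply: measurable_funTS; apply: measurable_funeM.
  exact: (measurable_inner_shell _ _ hV).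
- by apply: measurable_funTS; exact: (measurable_inner_symbol hV).
move=> th _; rewrite -ge0_integralZl_EFin //; last 3 first.
- exact: measurable_shell.
- by move=> r _; rewrite lee_fin osl_kernel_ge0.
- apply: measurable_funTS; apply/measurable_EFinP.
  exact: (measurable_kernel_slice _ _ hV).
have mk : measurable_fun setT (fun r => osl_kernel A xi (th, r) / r ^+ 2).
  apply: measurable_funM; first exact: (measurable_kernel_slice _ _ hV).
  exact: measurable_invr_sqr.
apply: (@le_trans _ _ (\int[lebesgue_measure]_(r in shell R n)
    (osl_kernel A xi (th, r) / r ^+ 2)%:E)%E).
  apply: ge0_le_integral => //.
  - exact: measurable_shell.
  - by move=> r _; rewrite -EFinM lee_fin mulr_ge0 // osl_kernel_ge0.
  - apply: measurable_funTS; apply: measurable_funeM; apply/measurable_EFinP.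
    exact: (measurable_kernel_slice _ _ hV).
  - by apply: measurable_funTS; exact/measurable_EFinP.
  - move=> r rn; have r0 := shell_gt0 rn.
    rewrite -EFinM lee_fin mulrC ler_wpM2l ?osl_kernel_ge0 //.
    rewrite lef_pV2 ?posrE ?exprn_gt0 //.
    rewrite ler_sqr ?nnegrE ?(ltW r0) //.
    by move: rn; rewrite /shell /= in_itv /= => /andP[].
apply: ge0_subset_integral => //.
- exact: measurable_shell.
- by apply: measurable_funTS; exact/measurable_EFinP.
- by move=> r _; rewrite lee_fin mulr_ge0 ?osl_kernel_ge0 // invr_ge0 sqr_ge0.
- by move=> r /shell_gt0 r0; rewrite /= in_itv /= r0.
Qed.

(** cos is 1-Lipschitz and theta is a unit vector, so the integrands differ by
    at most eps; the shell has length at most n + 1. *)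
Lemma shell_symbol_perturb m (A B : 'M[R]_d) (V V' : 'M[R]_(m, d)) (e e' : 'rV[R]_m)
    n xi eta (eps : R) :
  eigenframe A V e -> eigenframe B V' e' -> 0 <= eps ->
  (forall r, shell R n r -> enorm (rpow r A *m xi - rpow r B *m eta) <= eps) ->
  (shell_symbol B sigma n eta <=
   shell_symbol A sigma n xi + (eps * n.+1%:R)%:E * sigma (esphere R d))%E.
Proof.
move=> hV hV' eps0 H.
have ke th r : esphere R d th -> shell R n r ->
    osl_kernel B eta (th, r) <= osl_kernel A xi (th, r) + eps.
  move=> th1 rn; rewrite /osl_kernel /=.
  set t := dotp _ _; set t' := dotp _ _.
  have : `|cos t' - cos t| <= eps.
    apply: (le_trans (cos_lipschitz _ _)); apply: le_trans (H r rn).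
    have -> : t' - t = dotp (th : 'cV[R]_d) (rpow r A *m xi - rpow r B *m eta).
      rewrite -[- (rpow r B *m eta)]scaleN1r [RHS]dotpC dotpDl.
      by rewrite dotpZl mulN1r /t /t' ![dotp _ th]dotpC.
    by apply: (le_trans (norm_dotp_le _ _)); rewrite th1 mul1r.
  by rewrite ler_norml => /andP[]; lra.
rewrite -integral_cst // -ge0_integralD //; last 3 first.
- by move=> th _; exact: inner_shell_ge0.
- by apply: measurable_funTS; exact: (measurable_inner_shell _ _ hV).
- by move=> th _; rewrite lee_fin mulr_ge0.
apply: ge0_le_integral => //.
- by move=> th _; exact: inner_shell_ge0.
- by apply: measurable_funTS; exact: (measurable_inner_shell _ _ hV').
- apply: emeasurable_funD => //.
  by apply: measurable_funTS; exact: (measurable_inner_shell _ _ hV).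
move=> th th1.
have mk := measurable_kernel_slice xi th hV.
have mk' := measurable_kernel_slice eta th hV'.
apply: (@le_trans _ _ (\int[lebesgue_measure]_(r in shell R n)
   ((osl_kernel A xi (th, r))%:E + eps%:E))%E).
  apply: ge0_le_integral => //.
  - exact: measurable_shell.
  - by move=> r _; rewrite lee_fin osl_kernel_ge0.
  - by apply: measurable_funTS; exact/measurable_EFinP.
  - apply: measurable_funTS; apply: emeasurable_funD => //.
    exact/measurable_EFinP.
  - by move=> r rn; rewrite -EFinD lee_fin ke.
rewrite ge0_integralD //; last 3 first.
- exact: measurable_shell.
- by move=> r _; rewrite lee_fin osl_kernel_ge0.
- by apply: measurable_funTS; exact/measurable_EFinP.
apply: leeD => //.
rewrite integral_cst; last exact: measurable_shell.
by rewrite EFinM lee_wpmul2l // lebesgue_measure_shell.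
Qed.

Lemma shell_symbol_fin m (A : 'M[R]_d) (V : 'M[R]_(m, d)) (e : 'rV[R]_m) n xi :
  eigenframe A V e -> (shell_symbol A sigma n xi < +oo)%E.
Proof.
move=> hV.
apply: (@le_lt_trans _ _ ((2 * n.+1%:R)%:E * sigma (esphere R d))%E); last first.
  by rewrite lte_mul_pinfty // ?lee_fin ?mulr_ge0 // ltey_eq fin_num_measure.
rewrite -integral_cst //; apply: ge0_le_integral => //.
- by move=> th _; exact: inner_shell_ge0.
- by apply: measurable_funTS; exact: (measurable_inner_shell _ _ hV).
move=> th _; apply: (@le_trans _ _
  (\int[lebesgue_measure]_(r in shell R n) (2%:E : \bar R))%E).
  apply: ge0_le_integral => //.
  - exact: measurable_shell.
  - by move=> r _; rewrite lee_fin osl_kernel_ge0.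
  - apply: measurable_funTS; apply/measurable_EFinP.
    exact: (measurable_kernel_slice _ _ hV).
  - move=> r _; rewrite lee_fin /osl_kernel /=.
    have := cos_geN1 (dotp (th : 'cV[R]_d) (rpow r A *m xi)); lra.
rewrite integral_cst; last exact: measurable_shell.
by rewrite EFinM lee_wpmul2l // lebesgue_measure_shell.
Qed.

End Shell.

(** * Positivity for full measures *)

(** A continuous function that is positive at r0 is bounded away from 0 on a
    right neighbourhood of r0, which some shell contains. *)
Lemma shell_integrals_eq0 (R : realType) (h : R -> R) :
  measurable_fun setT h -> (forall r, 0 <= h r) ->
  (forall r, 0 < r -> {for r, continuous h}) ->
  (forall n, \int[lebesgue_measure]_(r in shell R n) (h r)%:E = 0)%E ->
  forall r, 0 < r -> h r = 0.
Proof.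
move=> mh h0 ch hn r0 r00; apply/eqP; apply: contraT => hr0.
have hp : 0 < h r0 by rewrite lt_neqAle eq_sym hr0 h0.
have : \forall r \near r0, h r0 / 2 < h r.
  apply: (cvgr_gt _ (ch r0 r00)).
  by rewrite ltr_pdivrMr // ltr_pMr // ltr1n.
move/nbhs_ballP => [delta /= d0 hd].
pose I := `[r0, r0 + delta / 2]%classic.
have [n [n1 n2]] : exists n, n.+1%:R^-1 <= r0 /\ r0 + delta / 2 <= n.+1%:R.
  have [n1 H1] := ltr_add_invr r00; rewrite add0r in H1.
  have s0 : 0 <= r0 + delta / 2.
    by apply: addr_ge0; [exact: ltW|apply: divr_ge0; [exact: ltW|]].
  have /andP[_ /ltW H2] := truncn_itv s0.
  exists (maxn n1 (Num.truncn (r0 + delta / 2))); split.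
    apply: le_trans (ltW H1); rewrite lef_pV2 ?posrE // ler_nat ltnS.
    exact: leq_maxl.
  by apply: (le_trans H2); rewrite ler_nat ltnS leq_maxr.
have mI : measurable I by exact: measurable_itv.
have mhI D : measurable_fun D (EFin \o h).
  by apply: measurable_funTS; exact/measurable_EFinP.
have : (\int[lebesgue_measure]_(r in I) (h r0 / 2)%:E <= 0)%E.
  rewrite -(hn n).
  apply: (@le_trans _ _ (\int[lebesgue_measure]_(r in I) (h r)%:E)%E).
    apply: ge0_le_integral => //.
    - by move=> r _; rewrite lee_fin divr_ge0.
    - exact: mhI.
    - move=> r; rewrite /I /= in_itv /= => /andP[r0r rd].
      rewrite lee_fin ltW //; apply: hd; rewrite /ball /=.
      rewrite distrC ger0_norm ?subr_ge0 // ltrBlDl.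
      by apply: (le_lt_trans rd); rewrite ltrD2l ltr_pdivrMr // ltr_pMr // ltr1n.
  apply: ge0_subset_integral => //.
  - exact: measurable_shell.
  - exact: mhI.
  - by move=> r _; rewrite lee_fin.
  - move=> r; rewrite /I /shell /= !in_itv /= => /andP[r0r rd].
    by rewrite (le_trans n1 r0r) (le_trans rd n2).
have IE : lebesgue_measure I = (delta / 2)%:E.
  rewrite /I lebesgue_measure_itv /= lte_fin ltrDl divr_gt0 //.
  by rewrite -EFinD addrC addKr.
rewrite integral_cst // -[X in (_ * X)%E]/(lebesgue_measure I) IE -EFinM lee_fin.
by rewrite leNgt mulr_gt0 // divr_gt0.
Qed.

(** The values of r |-> <th, r^A xi> lie in the discrete set 2 pi Z, and they
    tend to 0 as r tends to 0. Were one of them nonzero, the intermediate value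
    theorem would produce an absolute value v with 0 < v <= 1, where
    cos v <> 1. *)
Lemma dotp_rpow_eq0 (R : realType) (d m : nat) (A : 'M[R]_d)
    (V : 'M[R]_(m, d)) (e : 'rV[R]_m) (a : R) (xi th : 'cV[R]_d) :
  eigenframe A V e -> 0 < a -> (forall l, a <= e 0 l) -> xi != 0 ->
  (forall r, 0 < r -> cos (dotp th (rpow r A *m xi)) = 1) ->
  forall r, 0 < r -> dotp th (rpow r A *m xi) = 0.
Proof.
move=> hV a0 ae xi0 cos1 r1 r10; apply/eqP; apply: contraT => g1.
have xp := enorm_gt0 xi0.
pose g r := `|dotp th (rpow r A *m xi)|.
have gp : 0 < g r1 by rewrite normr_gt0.
pose v := Num.min (g r1) 1.
have v0 : 0 < v by rewrite lt_min gp ltr01.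
have th0 := enorm_ge0 th.
(* One is added to |th| only to have N > 0. *)
pose N := (enorm th + 1) * enorm xi.
have N0 : 0 < N by rewrite mulr_gt0 // ltr_wpDl.
pose q := (v / N) `^ (a^-1).
have q0 : 0 < q by rewrite powR_gt0 // divr_gt0.
have qa : q `^ a = v / N.
  by rewrite /q -powRrM mulVf ?gt_eqF // powRr1 // ltW // divr_gt0.
(* Below 1 the norm of r^A xi is at most r^a |xi|, and q^a = v / N. *)
pose r0 := Num.min (Num.min 1 q) r1.
have r00 : 0 < r0 by rewrite !lt_min ltr01 q0 r10.
have r0r1 : r0 <= r1 by rewrite /r0 ge_min lexx orbT.
have r0q : r0 <= q by rewrite /r0 ge_min ge_min lexx orbT.
have r01 : r0 <= 1 by rewrite /r0 ge_min ge_min lexx.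
have gr0 : g r0 <= v.
  apply: (le_trans (norm_dotp_le _ _)).
  apply: (@le_trans _ _ (enorm th * (r0 `^ a * enorm xi))).
    rewrite ler_wpM2l //; apply: (rpow_enorm_le hV) => //; first exact: powR_ge0.
    by move=> l; apply: ger_powR => //; rewrite r00 r01.
  apply: (@le_trans _ _ (enorm th * (v / N * enorm xi))).
    rewrite ler_wpM2l // ler_wpM2r ?enorm_ge0 // -qa.
    by apply: ge0_ler_powR; rewrite ?nnegrE ?(ltW r00) ?(ltW q0) ?(ltW a0).
  have -> : enorm th * (v / N * enorm xi) = v * (enorm th / (enorm th + 1)).
    by rewrite /N; field; rewrite !gt_eqF // ltr_wpDl.
  by rewrite ler_piMr ?(ltW v0) // ler_pdivrMr ?mul1r ?lerDl // ltr_wpDl.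
have vg1 : v <= g r1 by rewrite /v ge_min lexx.
have cgr (r : R) : 0 < r -> {for r, continuous g}.
  by move=> rp; apply: (cvg_norm (rpow_dotp_continuous (u := th) (v := xi) hV rp)).

have cg : {within `[r0, r1], continuous g}.
  apply/continuous_in_subspaceT => r; rewrite inE /= in_itv /= => /andP[r0r _].
  by apply: cgr; exact: lt_le_trans r0r.
have [|c cin gc] := @IVT R g r0 r1 v r0r1 cg.
  move: gr0 vg1; move: (g r0) (g r1) => y z y1 z1.
  by rewrite ge_min le_max y1 z1 orbT.
have c0 : 0 < c by move: cin; rewrite in_itv /= => /andP[+ _]; exact: lt_le_trans.
have cosv : cos v = 1 by rewrite -gc /g cos_norm cos1.
have : sin v = 0 by apply: cos1sin0; rewrite cosv normr1.
have : 0 < sin v.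
  apply: sin2_gt0; rewrite v0 /= (@le_lt_trans _ _ 1) ?ltr1n //.
  by rewrite /v ge_min lexx orbT.
by move=> /[swap] ->; rewrite ltxx.
Qed.

(** Fullness is a statement on the Levy measure; if all truncated symbols
    vanish, then for almost every theta the whole curve r |-> r^A theta stays
    in the hyperplane orthogonal to xi. *)
Lemma shell_symbol_neq0 (R : realType) (d m : nat) (E : 'cV[R]_d -> 'M[R]_d)
    (sigma : {finite_measure set (borelV R d) -> \bar R}) (x : 'cV[R]_d)
    (V : 'M[R]_(m, d)) (e : 'rV[R]_m) (a : R) (xi : 'cV[R]_d) :
  eigenframe (E x) V e -> 0 < a -> (forall l, a <= e 0 l) -> xi != 0 ->
  osl_levy E sigma x [set y | dotp (y : 'cV[R]_d) xi != 0] != 0%E ->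
  exists n, shell_symbol (E x) sigma n xi != 0%E.
Proof.
move=> hV a0 ae xi0; apply: contra_neqP => /forallNP H.
have mS := @measurable_esphere R d.
have Hn n : shell_symbol (E x) sigma n xi = 0%E.
  by apply/eqP; apply: contrapT => /negP; exact: H.
have aen n : \forall th \ae sigma, esphere R d th ->
    (\int[lebesgue_measure]_(r in shell R n)
      (osl_kernel (E x) xi (th, r))%:E = 0)%E.
  have mf := measurable_funTS (D := (esphere R d : set (borelV R d)))
    (measurable_inner_shell n xi hV).
  apply/(ae_eq_integral_abs sigma mS mf); rewrite -(Hn n).
  by apply: eq_integral => th _; rewrite gee0_abs // inner_shell_ge0.
pose B : set (borelV R d) := [set y | dotp (y : 'cV[R]_d) xi != 0].
pose G (p : borelV R d * R) : R :=
  \1_B (rpow p.2 (E x) *m (p.1 : 'cV[R]_d)) / p.2 ^+ 2.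
pose g (th : borelV R d) : \bar R :=
  (\int[lebesgue_measure]_(r in `]0%R, +oo[) (G (th, r))%:E)%E.
have mB : measurable B.
  rewrite (_ : B = (fun y : borelV R d => dotp (y : 'cV[R]_d) xi) @^-1` [set~ 0]).
    rewrite -[X in measurable X]setTI; apply: measurable_dotp => //.
    exact: measurableC.
  by apply/seteqP; split => y /= /eqP.
have mg : measurable_fun setT g.
  apply: (@measurable_fun_inner R _ (borelV R d) G).
  - exact: measurable_itv.
  - apply: measurable_funM; last first.
      by apply: (measurableT_comp (@measurable_invr_sqr R)); exact: measurable_snd.
    have mI : measurable_fun [set: borelV R d] (\1_B : borelV R d -> R).
      exact: measurable_indic.
    have mP := measurable_polar hV.
    exact: (measurableT_comp mI mP).
  - by move=> p; rewrite mulr_ge0 // invr_ge0 sqr_ge0.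
have gae : ae_eq sigma (esphere R d) g (cst 0%E).
  have /ae_foralln := aen; apply: filterS => th thn th1.
  have hn n := thn n th1.
  rewrite /g integral0_eq // => r /=; rewrite in_itv /= andbT => r0.
  have K0 : forall r, 0 < r -> osl_kernel (E x) xi (th, r) = 0.
    apply: shell_integrals_eq0 => //.
    - exact: (measurable_kernel_slice _ _ hV).
    - by move=> u; exact: osl_kernel_ge0.
    - move=> u u0; apply: cvgB; first exact: cvg_cst.
      have := rpow_dotp_continuous (u := th) (v := xi) hV u0.
      by apply: continuous_cvg; exact: continuous_cos.
  rewrite /G indicE memNset ?mul0r // /B /= (rpow_dotp hV).
  rewrite (dotp_rpow_eq0 hV a0 ae xi0) ?eqxx // => u u0.
  by apply/eqP; rewrite eq_sym -subr_eq0; apply/eqP; exact: (K0 u u0).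
transitivity (\int[sigma]_(th in esphere R d) g th)%E; first by [].
rewrite (ae_eq_integral (cst 0%E)) //.
- by rewrite integral0.
- exact: measurable_funTS.
Qed.

(** * The lower bound on the unit sphere *)

(** The spectrum is the finite set of diagonal entries, hence bounded, so that
    the infimum and the supremum in [lambda_min] and [lambda_max] are genuine
    bounds. *)
Lemma symmetric_frame (R : realType) (d : nat) (A : 'M[R]_d) : A^T = A ->
  exists (V : 'M[R]_(d + d, d)) (e : 'rV[R]_(d + d)),
    eigenframe A V e /\ forall l, lambda_min A <= e 0 l <= lambda_max A.
Proof.
move=> /symmetric_isometry[V [e [VV VA spec]]]; exists V, e; split => // l.
have mem : re_spectrum A (e 0 l) by rewrite spec; exists l.
have bnd k : `|e 0 k| <= \sum_j `|e 0 j|.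
  by rewrite (bigD1 k) //= lerDl; apply: sumr_ge0.
apply/andP; split.
  apply: ge_inf mem; exists (- \sum_j `|e 0 j|) => r; rewrite spec => -[k _ <-].
  by rewrite lerNl; apply: le_trans (bnd k); rewrite -normrN ler_norm.
apply: ub_le_sup mem; exists (\sum_j `|e 0 j|) => r; rewrite spec => -[k _ <-].
by apply: le_trans (bnd k); rewrite ler_norm.
Qed.

Lemma near_enormB_le (R : realType) (d : nat) (x0 : 'cV[R]_d) (delta : R) :
  0 < delta -> \forall x \near x0, enorm (x - x0) <= delta.
Proof.
move=> d0.
have H1 : (x - x0) @[x --> x0] --> x0 - x0.
  apply: (@cvg_mx_entry _ _ (nbhs x0)) => i j.
  rewrite [X in _ --> X]mxE; under eq_cvg do rewrite mxE.
  by apply: cvgD; [exact: coord_continuous|exact: cvg_cst].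
have H := cvg_comp _ _ H1 (@continuous_enorm R d _).
rewrite subrr enorm0 in H.
by apply: (cvgr_le _ H).
Qed.

(** Half of the value of a positive truncated symbol at (x0, xi0) survives in a
    neighbourhood. *)
Lemma polar_symbol_lower_near (R : realType) (d : nat) (E : 'cV[R]_d -> 'M[R]_d)
    (hE : admissible_exponent E)
    (sigma : {finite_measure set (borelV R d) -> \bar R}) (x0 xi0 : 'cV[R]_d) :
  full_measure (osl_levy E sigma x0) -> xi0 != 0 ->
  exists2 c : R, 0 < c & \forall p \near (x0, xi0),
    (c%:E <= polar_symbol (E p.1) sigma p.2)%E.
Proof.
move=> full xi0N; have [_ Esym _ [a a2 aE]] := hE.
have a0 : 0 < a by lra.
have [V0 [e0 [hV0 he0]]] := symmetric_frame (Esym x0).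
have ae0 l : a <= e0 0 l.
  by apply: (le_trans (aE x0)); have /andP[] := he0 l.
have [n Jn] := shell_symbol_neq0 hV0 a0 ae0 xi0N (full xi0 xi0N).
have [j jE] : exists j : R, shell_symbol (E x0) sigma n xi0 = j%:E.
  exists (fine (shell_symbol (E x0) sigma n xi0)); rewrite fineK //.
  rewrite ge0_fin_numE; first exact: (shell_symbol_fin sigma n xi0 hV0).
  exact: shell_symbol_ge0.
have j0 : 0 < j.
  move: Jn (shell_symbol_ge0 sigma (E x0) n xi0).
  by rewrite jE lee_fin lt_neqAle eq_sym eqe => -> ->.
have [S SE] : exists S : R, sigma (esphere R d) = S%:E.
  exists (fine (sigma (esphere R d))); rewrite fineK //.
  by apply: fin_num_measure; exact: measurable_esphere.
have S0 : 0 <= S by rewrite -lee_fin -SE measure_ge0.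
have N0 : 0 < n.+1%:R :> R by rewrite ltr0n.
(* S + 1 rather than S avoids a division by zero; the total error
   eps * (n + 1) * S is then at most j / 2. *)
pose eps := j / 2 / (n.+1%:R * (S + 1)).
have eps0 : 0 < eps by rewrite !divr_gt0 // mulr_gt0 // ltr_wpDl.
have lnN : 0 <= ln n.+1%:R :> R by apply: ln_ge0; rewrite ler1n.
have [delta delta0 H] := rpow_near hE x0 xi0 lnN eps0.
exists ((n.+1%:R ^+ 2)^-1 * (j / 2)).
  by rewrite mulr_gt0 ?divr_gt0 // invr_gt0 exprn_gt0.
exists ([set x | enorm (x - x0) <= delta], [set xi | enorm (xi - xi0) <= delta]).
  by split => /=; exact: near_enormB_le.
move=> [x xi] [/= xd xid].
have [V [e [hV _]]] := symmetric_frame (Esym x).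
apply: le_trans (shell_symbol_le sigma n xi hV).
rewrite EFinM; apply: lee_wpmul2l; first by rewrite lee_fin invr_ge0 sqr_ge0.
have P : (j%:E <= shell_symbol (E x) sigma n xi +
                  (eps * n.+1%:R)%:E * sigma (esphere R d))%E.
  rewrite -jE; apply: (shell_symbol_perturb sigma hV hV0 (ltW eps0)) => r rn.
  apply: H => //; rewrite ler_norml; have r0 := shell_gt0 rn.
  move: rn; rewrite /shell /= in_itv /= => /andP[r1 r2].
  by rewrite -lnV ?posrE // !ler_ln ?posrE ?invr_gt0 // r1 r2.
have epsE : eps * n.+1%:R * S <= j / 2.
  have -> : eps * n.+1%:R * S = j / 2 * (S / (S + 1)).
    rewrite /eps; move: (n.+1%:R : R) N0 => N N0.
    by field; rewrite !gt_eqF // ltr_wpDl.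
  rewrite ler_piMr ?divr_ge0 ?(ltW j0) // ler_pdivrMr ?ltr_wpDl //.
  by rewrite mul1r lerDl.
have {}P : (j%:E <= shell_symbol (E x) sigma n xi + (j / 2)%:E)%E.
  apply: (le_trans P); rewrite SE; apply: leeD2l.
  by rewrite -EFinM lee_fin.
have -> : j / 2 = j - j / 2 by field.
by rewrite EFinB leeBlDr.
Qed.

Lemma polar_symbol_lower (R : realType) (d : nat) (E : 'cV[R]_d -> 'M[R]_d)
    (hE : admissible_exponent E)
    (sigma : {finite_measure set (borelV R d) -> \bar R}) (K : set 'cV[R]_d) :
  compact K -> (forall x, K x -> full_measure (osl_levy E sigma x)) ->
  exists2 c : R, 0 < c & forall x xi, K x -> enorm xi = 1 ->
    (c%:E <= polar_symbol (E x) sigma xi)%E.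
Proof.
move=> cK full.
have cKS := compact_setX cK (@compact_esphere R d).
have /compact_near_coveringP cov := cKS.
pose P (c : R) (p : 'cV[R]_d * 'cV[R]_d) :=
  (c%:E <= polar_symbol (E p.1) sigma p.2)%E.
have H : \forall c \near (0 : R)^'+, K `*` esphere R d `<=` P c.
  apply: cov => -[x0 xi0] [/= Kx0 S0].
  have xi0N : xi0 != 0.
    apply/eqP => xi00; move: S0; rewrite /esphere /= xi00 enorm0 => /eqP.
    by rewrite eq_sym oner_eq0.
  have [c c0 Hc] := polar_symbol_lower_near hE (full _ Kx0) xi0N.
  exists ([set p | (c%:E <= polar_symbol (E p.1) sigma p.2)%E], [set c' | c' <= c]).
    by split => //=; exact: nbhs_right_le.
  move=> [p c'] [/= H1 H2]; apply: le_trans H1; by rewrite lee_fin.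
have [c [c0 cH]] : exists c : R, 0 < c /\ K `*` esphere R d `<=` P c.
  have [c [c0 cH]] := filter_ex (filterI (nbhs_right_gt (0 : R)) H).
  by exists c; split.
by exists c => // x xi Kx xi1; apply: (cH (x, xi)).
Qed.

(** * Rescaling and the estimates *)

Lemma polar_symbol0 (R : realType) (d : nat) (A : 'M[R]_d)
    (sigma : {finite_measure set (borelV R d) -> \bar R}) :
  polar_symbol A sigma 0 = 0%E.
Proof.
apply: integral0_eq => th _; apply: integral0_eq => r _.
rewrite /osl_kernel /= mulmx0 (_ : dotp _ _ = 0) ?cos0 ?subrr ?mul0r //.
by rewrite /dotp big1 // => i _; rewrite mxE mulr0.
Qed.

Lemma polar_symbol_ge0 (R : realType) (d : nat) (A : 'M[R]_d)
    (sigma : {finite_measure set (borelV R d) -> \bar R}) xi :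
  (0 <= polar_symbol A sigma xi)%E.
Proof. by apply: integral_ge0 => th _; exact: inner_symbol_ge0. Qed.

(** If t is squeezed between c^lo and c^hi, then t and 1 lie on the same side
    as c and 1, and extracting roots squeezes c between powers of t. *)
Lemma powR_root_bounds (R : realType) (c t lo hi : R) :
  0 < c -> 0 < lo -> 0 < hi ->
  (c <= 1 -> c `^ hi <= t /\ t <= c `^ lo) ->
  (1 <= c -> c `^ lo <= t /\ t <= c `^ hi) ->
  (t <= 1 -> t `^ (1 / lo) <= c /\ c <= t `^ (1 / hi)) /\
  (1 <= t -> t `^ (1 / hi) <= c /\ c <= t `^ (1 / lo)).
Proof.
move=> c0 lo0 hi0 Hle Hge.
have root p : 0 < p -> (c `^ p) `^ (1 / p) = c.
  by move=> p0; rewrite -powRrM mulrC divfK ?gt_eqF // powRr1 // ltW.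
have mono (p u v : R) : 0 < p -> 0 <= u -> u <= v -> u `^ (1 / p) <= v `^ (1 / p).
  move=> p0 u0 uv; apply: ge0_ler_powR; rewrite ?nnegrE //.
    by rewrite divr_ge0 // ltW.
  exact: le_trans uv.
have one p : 0 < p -> 1 `^ p = 1 :> R by rewrite powR1.
have strict (p u v : R) : 0 < p -> 0 <= u -> u < v -> u `^ p < v `^ p.
  move=> p0 u0 uv; apply: gt0_ltr_powR; rewrite ?nnegrE //.
  by rewrite (le_trans u0) // ltW.
have t0 : 0 <= t.
  case/orP: (le_total c 1) => [/Hle|/Hge] [h _]; apply: le_trans h; exact: powR_ge0.
split => t1.
- have c1 : c <= 1.
    rewrite leNgt; apply/negP => c1; have [h _] := Hge (ltW c1).
    have := strict lo 1 c lo0 ler01 c1; rewrite one //.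
    by rewrite ltNge (le_trans h t1).
  have [h1 h2] := Hle c1; split.
    by rewrite -[leRHS](root lo) // mono.
  by rewrite -[leLHS](root hi) // mono ?powR_ge0.
- have c1 : 1 <= c.
    rewrite leNgt; apply/negP => c1; have [_ h] := Hle (ltW c1).
    have := strict lo c 1 lo0 (ltW c0) c1; rewrite one //.
    by rewrite ltNge (le_trans t1 h).
  have [h1 h2] := Hge c1; split.
    by rewrite -[leRHS](root hi) // mono.
  by rewrite -[leLHS](root lo) // mono ?powR_ge0.
Qed.

Lemma symbol_rescaling (R : realType) (d : nat) (hd : (0 < d)%N) (A : 'M[R]_d)
    (a : R) (sigma : {finite_measure set (borelV R d) -> \bar R}) (xi : 'cV[R]_d) :
  A^T = A -> 0 < a -> a <= lambda_min A -> xi != 0 ->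
  exists c eta, [/\ 0 < c, enorm eta = 1,
    polar_symbol A sigma xi = (c%:E * polar_symbol A sigma eta)%E,
    (enorm xi <= 1 -> enorm xi `^ (1 / lambda_min A) <= c /\
                      c <= enorm xi `^ (1 / lambda_max A)) &
    (1 <= enorm xi -> enorm xi `^ (1 / lambda_max A) <= c /\
                      c <= enorm xi `^ (1 / lambda_min A))].
Proof.
move=> Asym a0 aA xi0; have [V [e [hV he]]] := symmetric_frame Asym.
have lo0 : 0 < lambda_min A by exact: lt_le_trans aA.
have hi0 : 0 < lambda_max A.
  have /andP[h1 h2] := he (lshift d (Ordinal hd)).
  by apply: lt_le_trans (le_trans h1 h2).
have elo l : lambda_min A <= e 0 l by have /andP[] := he l.
have ehi l : e 0 l <= lambda_max A by have /andP[] := he l.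
have [c [eta [c0 eta1 xiE]]] := rpow_sphere hV lo0 elo xi0.
exists c, eta.
have [||H1 H2] := @powR_root_bounds R c (enorm xi) _ _ c0 lo0 hi0.
- move=> c1; rewrite xiE -[c `^ _]mulr1 -[X in _ /\ _ <= X]mulr1 -eta1; split.
    apply: (rpow_enorm_ge hV) => //; first exact: powR_ge0.
    by move=> l; apply: ger_powR => //; rewrite c0.
  apply: (rpow_enorm_le hV) => //; first exact: powR_ge0.
  by move=> l; apply: ger_powR => //; rewrite c0.
- move=> c1; rewrite xiE -[c `^ _]mulr1 -[X in _ /\ _ <= X]mulr1 -eta1; split.
    apply: (rpow_enorm_ge hV) => //; first exact: powR_ge0.
    by move=> l; apply: ler_powR.
  apply: (rpow_enorm_le hV) => //; first exact: powR_ge0.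
  by move=> l; apply: ler_powR.
by split => //; rewrite xiE (polar_symbol_scale hV).
Qed.

Unset Implicit Arguments.

Theorem theorem2p24 (R : realType) (d : nat) (hd : (0 < d)%N)
  (E : 'cV[R]_d -> 'M[R]_d) (hE : admissible_exponent E)
  (sigma : {finite_measure set (borelV R d) -> \bar R})
  (hsph : spherical sigma) (hsym : symmetric_measure sigma)
  (K : set 'cV[R]_d) (hK : compact K) :
  exists C1 C2 C3 C4 : R,
    [/\ 0 < C1, 0 < C2, 0 < C3 & 0 < C4] /\
    (forall x xi : 'cV[R]_d,
      (enorm xi <= 1 ->
        (`| osl_symbol E sigma x xi |
          <= (C1 * enorm xi `^ (1 / lambda_max (E x)))%:E)%E) /\
      (1 <= enorm xi ->
        (`| osl_symbol E sigma x xi |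
          <= (C2 * enorm xi `^ (1 / lambda_min (E x)))%:E)%E)) /\
    ((forall x, K x -> full_measure (osl_levy E sigma x)) ->
     forall x xi : 'cV[R]_d, K x ->
      (enorm xi <= 1 ->
        ((C3 * enorm xi `^ (1 / lambda_min (E x)))%:E
          <= `| osl_symbol E sigma x xi |)%E) /\
      (1 <= enorm xi ->
        ((C4 * enorm xi `^ (1 / lambda_max (E x)))%:E
          <= `| osl_symbol E sigma x xi |)%E)).
Proof.
have [_ Esym _ [a a2 aE]] := hE.
have a0 : 0 < a by lra.
have Sfin : sigma (esphere R d) \is a fin_num.
  by apply: fin_num_measure; exact: measurable_esphere.
pose C := ((2 * a - 1)^-1 + 2) * fine (sigma (esphere R d)) + 1.
have CE xi x : enorm xi = 1 -> (polar_symbol (E x) sigma xi <= C%:E)%E.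
  move=> xi1; have [V [e [hV he]]] := symmetric_frame (Esym x).
  apply: (le_trans (polar_symbol_upper sigma hV a2 _ xi1)).
    by move=> l; apply: (le_trans (aE x)); have /andP[] := he l.
  by rewrite -[sigma _]fineK // -EFinM lee_fin lerDl.
have C0 : 0 < C.
  rewrite ltr_wpDl // mulr_ge0 //; last by apply: fine_ge0; exact: measure_ge0.
  by rewrite addr_ge0 // invr_ge0; lra.
have symE x xi : `|osl_symbol E sigma x xi|%E = polar_symbol (E x) sigma xi.
  have [V [e [hV _]]] := symmetric_frame (Esym x).
  by rewrite (osl_symbolE sigma hV xi (erefl (E x))) gee0_abs // polar_symbol_ge0.
have lo0 x : 0 < lambda_min (E x) by exact: lt_le_trans (aE x).
have hi0 x : 0 < lambda_max (E x).
  have [V [e [_ /(_ (lshift d (Ordinal hd)))/andP[h1 h2]]]] :=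
    symmetric_frame (Esym x).
  exact: lt_le_trans (lo0 x) (le_trans h1 h2).
have zero p : 0 < p -> (0 : R) `^ (1 / p) = 0.
  by move=> p0; rewrite powR0 // gt_eqF // divr_gt0.
have [c [c0 cE]] : exists c : R, 0 < c /\
   ((forall x, K x -> full_measure (osl_levy E sigma x)) ->
    forall x xi, K x -> enorm xi = 1 -> (c%:E <= polar_symbol (E x) sigma xi)%E).
  have [full|nfull] := pselect (forall x, K x -> full_measure (osl_levy E sigma x)).
    by have [c c0 cE] := polar_symbol_lower hE hK full; exists c.
  by exists 1; split => // /nfull.
(* Both regimes of |xi| get the same constants. The case xi = 0 is separate: it
   is not on the orbit of a unit vector, and both sides vanish there. *)
exists C, C, c, c; split=> //; split=> [x xi|full x xi Kx].
  rewrite symE; have [->|xi0] := eqVneq xi 0.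
    rewrite enorm0 polar_symbol0; split => [_|].
      by rewrite zero // mulr0.
    by rewrite leNgt ltr01.
  have [s [eta [s0 eta1 -> H1 H2]]] :=
    symbol_rescaling hd sigma (Esym x) a0 (aE x) xi0.
  have key t : s <= t -> (s%:E * polar_symbol (E x) sigma eta <= (C * t)%:E)%E.
    move=> st; apply: (@le_trans _ _ (s%:E * C%:E)%E).
      by rewrite lee_wpmul2l ?lee_fin ?(ltW s0) // CE.
    by rewrite -EFinM lee_fin mulrC ler_pM2l.
  by split => [/H1|/H2] [_ h]; exact: key.
rewrite symE; have [->|xi0] := eqVneq xi 0.
  rewrite enorm0 polar_symbol0; split => [_|].
    by rewrite zero // mulr0.
  by rewrite leNgt ltr01.
have [s [eta [s0 eta1 -> H1 H2]]] :=
  symbol_rescaling hd sigma (Esym x) a0 (aE x) xi0.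
have key t : t <= s -> ((c * t)%:E <= s%:E * polar_symbol (E x) sigma eta)%E.
  move=> ts; apply: (@le_trans _ _ (s%:E * c%:E)%E).
    by rewrite -EFinM lee_fin [leRHS]mulrC ler_pM2l.
  by rewrite lee_wpmul2l ?lee_fin ?(ltW s0) // cE.
by split => [/H1|/H2] [h _]; exact: key.
Qed.
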